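(* Let $\xi(j)$ and $\eta(j)$, $j\in\mathbb Z$, be zero mean uncorrelated wide sense stationary sequences with spectral densities $f(\lambda)$ and $g(\lambda)$ satisfying the minimality condition $\int_{-\pi}^\pi(f(\lambda)+g(\lambda))^{-1}d\lambda<\infty$. Let $N\ge0$, $\mathbf a_N=(a(0),\dots,a(N))\in\mathbb C^{N+1}$, and let $\mathbf B_N,\mathbf R_N,\mathbf Q_N$ be the $(N+1)\times(N+1)$ matrices with entries ($j,k=0,\dots,N$) $$B^N_{j,k}=\frac1{2\pi}\int_{-\pi}^\pi\frac{e^{-i(j-k)\lambda}}{f+g}d\lambda,\quad R^N_{j,k}=\frac1{2\pi}\int_{-\pi}^\pi e^{-i(j-k)\lambda}\frac{f}{f+g}d\lambda,\quad Q^N_{j,k}=\frac1{2\pi}\int_{-\pi}^\pi e^{-i(j-k)\lambda}\frac{fg}{f+g}d\lambda .$$ Then the optimal linear estimate $\hat A_N\xi$ of $A_N\xi=\sum_{j=0}^Na(j)\xi(j)$ based on observations of $\xi(j)+\eta(j)$ at $j\in\mathbb Z\setminus\{0,1,\dots,N\}$ has spectral characteristic $$h(e^{i\lambda})=A_N(e^{i\lambda})\frac{f(\lambda)}{f(\lambda)+g(\lambda)}-\frac{\sum_{k=0}^N(\mathbf B_N^{-1}\mathbf R_N\mathbf a_N)_ke^{ik\lambda}}{f(\lambda)+g(\lambda)},\qquad A_N(e^{i\lambda})=\sum_{j=0}^Na(j)e^{ij\lambda},$$ and mean square error $$\Delta(h;f,g)=E|A_N\xi-\hat A_N\xi|^2=\langle\mathbf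 R_N\mathbf a_N,\mathbf B_N^{-1}\mathbf R_N\mathbf a_N\rangle+\langle\mathbf Q_N\mathbf a_N,\mathbf a_N\rangle .$$
   Context: $E\xi(j+k)\overline{\xi(j)}=\frac1{2\pi}\int_{-\pi}^\pi e^{ik\lambda}f(\lambda)d\lambda$, and similarly for $\eta$ with $g$; $\xi(j)=\int e^{ij\lambda}Z_\xi(d\lambda)$, $\eta(j)=\int e^{ij\lambda}Z_\eta(d\lambda)$ with orthogonal stochastic measures. $\langle x,y\rangle=\sum_{k=0}^Nx_k\overline{y_k}$. $L_2^N(f+g)$ is the closed subspace of $L_2(f+g)$ generated by $\{e^{ij\lambda}:j\in\mathbb Z\setminus\{0,\dots,N\}\}$. A linear estimate has the form $\hat A_N\xi=\int h(e^{i\lambda})(Z_\xi(d\lambda)+Z_\eta(d\lambda))$ with spectral characteristic $h\in L_2^N(f+g)$ and error $\Delta(h;f,g)=\frac1{2\pi}\int_{-\pi}^\pi|A_N-h|^2f\,d\lambda+\frac1{2\pi}\int_{-\pi}^\pi|h|^2g\,d\lambda$; the optimal one minimizes this error. *)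

(* Defs.v *)
From HB Require Import structures.
From mathcomp Require Import all_boot all_order all_algebra.
From mathcomp Require Import all_classical all_reals all_analysis.
From mathcomp Require Export complex.

Set Implicit Arguments.
Unset Strict Implicit.
Unset Printing Implicit Defensive.

Import Order.TTheory GRing.Theory Num.Theory.
Import numFieldNormedType.Exports.

Local Open Scope classical_set_scope.
Local Open Scope ring_scope.
Local Open Scope complex_scope.

Section ComplexIntegration.
Context {d} {T : measurableType d} {R : realType}.

Definition sqmod (z : R[i]) : R := complex.Re z ^+ 2 + complex.Im z ^+ 2.

Definition cmeasurable (D : set T) (u : T -> R[i]) : Prop :=
  measurable_fun D (fun x => complex.Re (u x)) /\
  measurable_fun D (fun x => complex.Im (u x)).

(* Meaningful when the real and imaginary parts are integrable, which is the
   case wherever it is used below. *)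
Definition cintegral (mu : {measure set T -> \bar R}) (D : set T) (u : T -> R[i]) : R[i] :=
  (\int[mu]_(x in D) complex.Re (u x)) +i* (\int[mu]_(x in D) complex.Im (u x)).

End ComplexIntegration.

Section SecondOrder.
Context {d} {T : measurableType d} {R : realType} (P : probability T R).

Definition cexpectation (X : T -> R[i]) : R[i] := cintegral P setT X.

(* [E |X|^2], with value +oo allowed *)
Definition mean_square (X : T -> R[i]) : \bar R := 'E_P[fun w => sqmod (X w)]%E.

Definition second_order (X : T -> R[i]) : Prop :=
  cmeasurable setT X /\ (mean_square X < +oo)%E.

Definition ccovariance (X Y : T -> R[i]) : R[i] :=
  cexpectation (fun w =>
    (X w - cexpectation X) * conjc (Y w - cexpectation Y)).

Definition zero_mean (X : int -> T -> R[i]) : Prop :=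
  forall j, cexpectation (X j) = 0.

Definition wide_sense_stationary (X : int -> T -> R[i]) : Prop :=
  [/\ forall j, second_order (X j),
      forall j k, cexpectation (X j) = cexpectation (X k) &
      forall j l k, ccovariance (X (j + k)) (X j) = ccovariance (X (l + k)) (X l)].

Definition uncorrelated (X Y : int -> T -> R[i]) : Prop :=
  forall j k, ccovariance (X j) (Y k) = 0.

End SecondOrder.

Section Spectral.
Context {R : realType}.

(* Functions on the unit circle are represented as functions of the argument
   [x] in [-pi, pi]; only their values on this interval matter. *)
Definition circle : set R := `[- pi, pi].

Definition expi (x : R) : R[i] := cos x +i* sin x.

(* [e^{ijx}] *)
Definition chi (j : int) (x : R) : R[i] := expi (j%:~R * x).

Definition fourier (k : int) (u : R -> R) : R[i] :=
  ((2 * pi)^-1)%:C * cintegral lebesgue_measure circle (fun x => chi k x * (u x)%:C).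

(* the squared norm of [u] in [L_2(w)] *)
Definition L2normsq (w : R -> R) (u : R -> R[i]) : \bar R :=
  (((2 * pi)^-1)%:E *
   \int[lebesgue_measure]_(x in circle) (sqmod (u x) * w x)%:E)%E.

Definition inL2 (w : R -> R) (u : R -> R[i]) : Prop :=
  cmeasurable circle u /\ (L2normsq w u < +oo)%E.

(* The closed subspace of [L_2(w)] generated by the exponentials [chi j] with
   [j] outside of {0, ..., N}. *)
Definition inL2N (w : R -> R) (N : nat) (h : R -> R[i]) : Prop :=
  inL2 w h /\
  forall e : R, 0 < e ->
  exists (J : seq int) (c : int -> R[i]),
    (forall j, j \in J -> ~~ (0 <= j <= N%:Z)) /\
    (L2normsq w (fun x => h x - \sum_(j <- J) c j * chi j x)%R < e%:E)%E.

(* In [\bar R] the inverse of 0 is +oo. *)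
Definition minimality (f g : R -> R) : Prop :=
  (\int[lebesgue_measure]_(x in circle) ((f x + g x)%:E)^-1 < +oo)%E.

Section Random.
Context {d} {T : measurableType d} (P : probability T R).

Definition spectral_density (X : int -> T -> R[i]) (f : R -> R) : Prop :=
  [/\ forall x, circle x -> 0 <= f x,
      lebesgue_measure.-integrable circle (EFin \o f) &
      forall j k : int,
        cexpectation P (fun w => X (j + k) w * conjc (X j w)) = fourier k f].

(* Orthogonal stochastic measure on [-pi, pi] with structure function
   [F(dx) = w(x) dx / (2 pi)]. Its countable additivity in mean square follows
   from that of [F]. *)
Definition orthogonal_stochastic_measure
    (w : R -> R) (Z : set R -> T -> R[i]) : Prop :=
  [/\ forall A, measurable A -> A `<=` circle -> second_order P (Z A),
      forall A B, measurable A -> measurable B ->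
        A `<=` circle -> B `<=` circle -> A `&` B = set0 ->
        {ae P, forall t, Z (A `|` B) t = Z A t + Z B t} &
      forall A B, measurable A -> measurable B ->
        A `<=` circle -> B `<=` circle ->
        cexpectation P (fun t => Z A t * conjc (Z B t)) =
        ((2 * pi)^-1 * \int[lebesgue_measure]_(x in A `&` B) w x)%:C].

(* Simple functions are finite sums of [c * \1_A], given as lists of [(c, A)]. *)
Definition simple_wf (s : seq (R[i] * set R)) : Prop :=
  forall i, (i < size s)%N ->
    measurable (nth (0, set0) s i).2 /\ (nth (0, set0) s i).2 `<=` circle.

Definition simple_fun (s : seq (R[i] * set R)) (x : R) : R[i] :=
  \sum_(cA <- s) cA.1 * (\1_(cA.2) x)%:C.

Definition simple_integral
    (Z : set R -> T -> R[i]) (s : seq (R[i] * set R)) (t : T) : R[i] :=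
  \sum_(cA <- s) cA.1 * Z cA.2 t.

(* [Y] is (a version of) the mean square stochastic integral of [h] in [L_2(w)]
   with respect to [Z]. *)
Definition stochastic_integral (w : R -> R) (Z : set R -> T -> R[i])
    (h : R -> R[i]) (Y : T -> R[i]) : Prop :=
  [/\ inL2 w h, second_order P Y &
    exists s : nat -> seq (R[i] * set R),
      [/\ forall n, simple_wf (s n),
          (fun n => L2normsq w (fun x => h x - simple_fun (s n) x)) @ \oo
            --> 0%E &
          (fun n => mean_square P (fun t => Y t - simple_integral Z (s n) t))
            @ \oo --> 0%E]].

End Random.
End Spectral.

Section Interpolation.
Context {R : realType} (f g : R -> R) (N : nat).

(* [A_N(e^{ix})] *)
Definition trigpoly (a : 'cV[R[i]]_N.+1) (x : R) : R[i] :=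
  \sum_(j < N.+1) a j 0 * chi j x.

(* entries [1/(2 pi) \int e^{-i(j-k)x} u(x) dx] *)
Definition toeplitz (u : R -> R) : 'M[R[i]]_N.+1 :=
  \matrix_(j, k) fourier (- (j%:Z - k%:Z)) u.

Definition matB := toeplitz (fun x => (f x + g x)^-1).
Definition matR := toeplitz (fun x => f x / (f x + g x)).
Definition matQ := toeplitz (fun x => f x * g x / (f x + g x)).

Definition dotc (x y : 'cV[R[i]]_N.+1) : R[i] :=
  \sum_(k < N.+1) x k 0 * conjc (y k 0).

(* [Delta(h; f, g)] *)
Definition Delta (a : 'cV[R[i]]_N.+1) (h : R -> R[i]) : \bar R :=
  (L2normsq f (fun x => trigpoly a x - h x)%R + L2normsq g h)%E.

Definition hopt (a : 'cV[R[i]]_N.+1) (x : R) : R[i] :=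
  trigpoly a x * (f x / (f x + g x))%:C
  - trigpoly (invmx matB *m (matR *m a)) x / (f x + g x)%:C.

Context {d} {T : measurableType d} (P : probability T R).

(* [A_N xi] *)
Definition functional (xi : int -> T -> R[i]) (a : 'cV[R[i]]_N.+1) (t : T) :=
  \sum_(j < N.+1) a j 0 * xi j t.

(* [Y] is the linear estimate with spectral characteristic [h]. *)
Definition linear_estimate (Zxi Zeta : set R -> T -> R[i])
    (h : R -> R[i]) (Y : T -> R[i]) : Prop :=
  inL2N (fun x => f x + g x) N h /\
  stochastic_integral P (fun x => f x + g x)
    (fun A t => Zxi A t + Zeta A t) h Y.

Definition optimal_linear_estimate (Zxi Zeta : set R -> T -> R[i])
    (a : 'cV[R[i]]_N.+1) (h : R -> R[i]) (Y : T -> R[i]) : Prop :=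
  linear_estimate Zxi Zeta h Y /\
  forall h', inL2N (fun x => f x + g x) N h' -> (Delta a h <= Delta a h')%E.

End Interpolation.

(* Main.v *)
(* Completing the square, with w = f + g,
     f |A - h|^2 + g |h|^2 = w |h - A f / w|^2 + |A|^2 f g / w,
   turns the minimization of Delta into the projection of A f / w on the closed
   span L_2^N(w) of the observed exponentials. The functions e^{ikx} / w, which
   belong to L_2(w) by minimality, are biorthogonal to the exponentials, so
   L_2^N(w) is contained in the orthogonal complement of e^{ikx} / w, 0 <= k <= N;
   the two spaces are equal because trigonometric polynomials are dense in L_2(w)
   and the coefficients of indices 0, ..., N of a good approximation are small.
   The projection is therefore obtained by subtracting from A f / w a combination
   of the e^{ikx} / w; the normal equations have Gram matrix B and right-hand
   side R a.

   For the identity Delta(h) = E |A_N xi - Y|^2, approximate h by trigonometric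
   polynomials p in L_2(w): the integral of p is a finite combination of the
   xi(j) + eta(j), for which the identity is a computation with covariances, and
   the integral with respect to Z_xi + Z_eta is bounded on L_2(w). *)
Require Import Defs.
From mathcomp Require Import all_boot all_order all_algebra.
From mathcomp Require Import all_classical all_reals all_analysis.
From mathcomp Require Import measurable_realfun ring lra.

Set Implicit Arguments.
Unset Strict Implicit.
Unset Printing Implicit Defensive.

Import Order.TTheory GRing.Theory Num.Theory.
Import numFieldNormedType.Exports.

Local Open Scope classical_set_scope.
Local Open Scope ring_scope.
Local Open Scope complex_scope.

(** Two facts about L_2 spaces carry the proof: trigonometric polynomials are dense in L_2(w) for a
    weight that is merely integrable, and mean square limits exist, so that the estimate exists as a
    random variable. Density is obtained through sets: those with approximable indicator form a
    sigma-algebra, and it contains the rays because suitable polynomials in a shifted sine converge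
    pointwise to the indicator of a half circle.

    Uncorrelatedness is assumed of the sequences [xi] and [eta], not of [Zxi] and [Zeta]. The
    integral with respect to the sum of the measures is therefore only shown to be bounded, with
    constant 2, and exact identities are taken from the sequences.

    Norms are kept squared, and |a + b|^2 <= 2 |a|^2 + 2 |b|^2 replaces the triangle inequality;
    most numerical constants below absorb these factors 2.

    At zeros of f + g real division returns 0, whereas the extended inverse in [minimality] is +oo.
    Such zeros form a null set, and f = g = 0 there, so several identities hold pointwise and others
    almost everywhere. *)

Section ComplexFunctions.
Context {R : realType}.
Implicit Types a b : R[i].

(** * Squared modulus and measurability of complex functions *)

Lemma sqmod_ge0 a : 0 <= sqmod a.
Proof. by rewrite addr_ge0// sqr_ge0. Qed.

Lemma sqmodM a b : sqmod (a * b) = sqmod a * sqmod b.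
Proof. by case: a b => [x y] [u v]; rewrite /sqmod /=; ring. Qed.

Lemma sqmodN a : sqmod (- a) = sqmod a.
Proof. by case: a => [x y]; rewrite /sqmod /= !sqrrN. Qed.

Lemma sqmodB a b : sqmod (a - b) = sqmod (b - a).
Proof. by rewrite -sqmodN opprB. Qed.

Lemma sqmodC (r : R) : sqmod (r%:C) = r ^+ 2.
Proof. by rewrite /sqmod /= expr0n addr0. Qed.

Lemma sqmod0 : sqmod (0 : R[i]) = 0.
Proof. by rewrite sqmodC expr0n. Qed.

Lemma sqmod_conj a : sqmod (conjc a) = sqmod a.
Proof. by case: a => [x y]; rewrite /sqmod /= sqrrN. Qed.

Lemma conjcM a b : conjc (a * b) = conjc a * conjc b.
Proof. exact: rmorphM. Qed.

Lemma mulcJ_sqmod a : a * conjc a = (sqmod a)%:C.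
Proof.
by case: a => [x y]; rewrite /sqmod; apply/eqP; rewrite eq_complex /=;
  apply/andP; split; apply/eqP; ring.
Qed.

Lemma sqmod_eq0 a : (sqmod a == 0) = (a == 0).
Proof.
by case: a => [x y]; rewrite eq_complex /sqmod /= paddr_eq0 ?sqr_ge0// !sqrf_eq0.
Qed.

(** The parallelogram law with the term |a - b|^2 dropped. It stands in for the triangle inequality
    in every later estimate, which avoids square roots. *)
Lemma sqmodD_le a b : sqmod (a + b) <= 2 * sqmod a + 2 * sqmod b.
Proof.
case: a b => [x y] [u v]; rewrite /sqmod /=.
have := sqr_ge0 (x - u); have := sqr_ge0 (y - v); nra.
Qed.

(** A crude form of 2 |a b| <= |a|^2 + |b|^2: it serves only as an integrable bound for products in
    [inner_integrable]. *)
Lemma ReMJ_le a b : `|complex.Re (a * conjc b)| <= sqmod a + sqmod b.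
Proof.
case: a b => [x y] [u v]; rewrite /sqmod /= ler_norml.
have := sqr_ge0 (x - u); have := sqr_ge0 (y - v).
have := sqr_ge0 (x + u); have := sqr_ge0 (y + v).
have := sqr_ge0 x; have := sqr_ge0 y; have := sqr_ge0 u; have := sqr_ge0 v.
by move=> *; apply/andP; split; nra.
Qed.

Lemma ImMJ_le a b : `|complex.Im (a * conjc b)| <= sqmod a + sqmod b.
Proof.
case: a b => [x y] [u v]; rewrite /sqmod /= ler_norml.
have := sqr_ge0 (x - v); have := sqr_ge0 (y - u).
have := sqr_ge0 (x + v); have := sqr_ge0 (y + u).
have := sqr_ge0 x; have := sqr_ge0 y; have := sqr_ge0 u; have := sqr_ge0 v.
by move=> *; apply/andP; split; nra.
Qed.

Context {d} {T : measurableType d} (D : set T).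
Implicit Types u v : T -> R[i].

Lemma cmeasurable_cst a : cmeasurable D (fun=> a).
Proof. by split; exact: measurable_cst. Qed.

Lemma cmeasurableC (r : T -> R) :
  measurable_fun D r -> cmeasurable D (fun x => (r x)%:C).
Proof. by move=> mr; split => //=; exact: measurable_cst. Qed.

Lemma cmeasurableD u v :
  cmeasurable D u -> cmeasurable D v -> cmeasurable D (fun x => u x + v x).
Proof.
move=> [mu1 mu2] [mv1 mv2]; split.
- by apply: (eq_measurable_fun
    (fun x => complex.Re (u x) + complex.Re (v x))) => [x _|];
    [case: (u x) (v x) => ? ? [] | exact: measurable_funD].
- by apply: (eq_measurable_fun
    (fun x => complex.Im (u x) + complex.Im (v x))) => [x _|];
    [case: (u x) (v x) => ? ? [] | exact: measurable_funD].
Qed.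

Lemma cmeasurableM u v :
  cmeasurable D u -> cmeasurable D v -> cmeasurable D (fun x => u x * v x).
Proof.
move=> [mu1 mu2] [mv1 mv2]; split.
- apply: (eq_measurable_fun (fun x => complex.Re (u x) * complex.Re (v x)
    - complex.Im (u x) * complex.Im (v x))) => [x _|].
    by case: (u x) (v x) => ? ? [].
  by apply: measurable_funB; exact: measurable_funM.
- apply: (eq_measurable_fun (fun x => complex.Re (u x) * complex.Im (v x)
    + complex.Im (u x) * complex.Re (v x))) => [x _|].
    by case: (u x) (v x) => ? ? [].
  by apply: measurable_funD; exact: measurable_funM.
Qed.

Lemma cmeasurableJ u : cmeasurable D u -> cmeasurable D (fun x => conjc (u x)).
Proof.
move=> [mu1 mu2]; split.
- by apply: (eq_measurable_fun (fun x => complex.Re (u x))) => // x _; case: (u x).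
- apply: (eq_measurable_fun (fun x => - complex.Im (u x))) => [x _|].
    by case: (u x).
  exact: measurableT_comp.
Qed.

Lemma cmeasurableB u v :
  cmeasurable D u -> cmeasurable D v -> cmeasurable D (fun x => u x - v x).
Proof.
move=> mu mv; have := cmeasurableD mu (cmeasurableM (cmeasurable_cst (-1)) mv).
by under eq_fun do rewrite mulN1r.
Qed.

Lemma measurable_sqmod u :
  cmeasurable D u -> measurable_fun D (fun x => sqmod (u x)).
Proof.
by move=> [mu1 mu2]; apply: measurable_funD; exact: measurable_funX.
Qed.

End ComplexFunctions.

(** * Linearity of the complex integral *)

Section ComplexIntegral.
Context {d} {T : measurableType d} {R : realType}.
Variables (mu : {measure set T -> \bar R}) (D : set T).
Hypothesis mD : measurable D.
Implicit Types (u v : T -> R[i]) (c : R[i]).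

Definition cintegrable u : Prop :=
  mu.-integrable D (EFin \o (fun x => complex.Re (u x))) /\
  mu.-integrable D (EFin \o (fun x => complex.Im (u x))).

Lemma cintegralD u v : cintegrable u -> cintegrable v ->
  cintegral mu D (fun x => u x + v x) = cintegral mu D u + cintegral mu D v.
Proof.
move=> [iu1 iu2] [iv1 iv2]; rewrite /cintegral.
apply/eqP; rewrite eq_complex /=; apply/andP; split; apply/eqP.
- by rewrite -RintegralD//; apply: eq_Rintegral => x _; case: (u x) (v x) => ? ? [].
- by rewrite -RintegralD//; apply: eq_Rintegral => x _; case: (u x) (v x) => ? ? [].
Qed.

Lemma cintegralZ c u : cintegrable u ->
  cintegral mu D (fun x => c * u x) = c * cintegral mu D u.
Proof.
case: c => [c1 c2] [iu1 iu2]; rewrite /cintegral.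
have iZ (r : R) (h : T -> R) : mu.-integrable D (EFin \o h) ->
    mu.-integrable D (EFin \o (fun x => r * h x)).
  by move=> ih; apply: eq_integrable (integrableZl mD r ih) => // x _ /=;
    rewrite EFinM.
apply/eqP; rewrite eq_complex /=; apply/andP; split; apply/eqP.
- by rewrite -!RintegralZl// -RintegralB//; [|exact: iZ..];
    apply: eq_Rintegral => x _; case: (u x).
- by rewrite -!RintegralZl// -RintegralD//; [|exact: iZ..];
    apply: eq_Rintegral => x _; case: (u x).
Qed.

Lemma cintegralJ u : cintegrable u ->
  cintegral mu D (fun x => conjc (u x)) = conjc (cintegral mu D u).
Proof.
move=> [iu1 iu2]; rewrite /cintegral.
apply/eqP; rewrite eq_complex /=; apply/andP; split; apply/eqP.
- by apply: eq_Rintegral => x _; case: (u x).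
- rewrite -mulN1r -RintegralZl//.
  by apply: eq_Rintegral => x _; case: (u x) => ? ?; rewrite mulN1r.
Qed.

Lemma eq_cintegral u v : {in D, u =1 v} -> cintegral mu D u = cintegral mu D v.
Proof.
by move=> uv; rewrite /cintegral; congr (_ +i* _);
  apply: eq_Rintegral => x Dx; rewrite uv.
Qed.

Lemma cintegral_ofreal (r : T -> R) :
  cintegral mu D (fun x => (r x)%:C) = (\int[mu]_(x in D) r x)%:C.
Proof. by rewrite /cintegral /=; congr (_ +i* _); rewrite Rintegral_cst// mul0r. Qed.

End ComplexIntegral.

(** * Weighted L_2 spaces, their inner product and the Cauchy-Schwarz inequality *)

Section WeightedL2.
Context {d} {T : measurableType d} {R : realType}.
Variables (mu : {measure set T -> \bar R}) (D : set T) (w : T -> R).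
Implicit Types (u v : T -> R[i]) (c : R[i]).

(** The weight is a parameter so that one theory covers both L_2 on the circle, with weight
    [density w], and second-order random variables, with weight 1. *)
Definition enormsq u : \bar R := (\int[mu]_(x in D) (sqmod (u x) * w x)%:E)%E.
Definition L2 u : Prop := cmeasurable D u /\ (enormsq u < +oo)%E.
(** [fine] sends +oo to 0, so this is the true squared norm only for members of [L2]; [enormsqE] is
    the bridge. *)
Definition normsq u : R := fine (enormsq u).
Definition inner u v : R[i] :=
  cintegral mu D (fun x => u x * conjc (v x) * (w x)%:C).

Hypothesis mD : measurable D.
Hypothesis mw : measurable_fun D w.
Hypothesis w0 : forall x, D x -> 0 <= w x.

Let mdens u : cmeasurable D u ->
  measurable_fun D (fun x => (sqmod (u x) * w x)%:E : \bar R).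
Proof.
move=> mu_; apply/measurable_EFinP; apply: measurable_funM => //.
exact: measurable_sqmod.
Qed.

Let dens_ge0 u x : D x -> (0 <= (sqmod (u x) * w x)%:E)%E.
Proof. by move=> Dx; rewrite lee_fin mulr_ge0 ?sqmod_ge0 ?w0. Qed.

Lemma enormsq_ge0 u : (0 <= enormsq u)%E.
Proof. by apply: integral_ge0 => x Dx; exact: dens_ge0. Qed.

Lemma normsq_ge0 u : 0 <= normsq u.
Proof. exact/fine_ge0/enormsq_ge0. Qed.

Lemma enormsqE u : L2 u -> enormsq u = (normsq u)%:E.
Proof.
by move=> [_ fu]; rewrite /normsq fineK// ge0_fin_numE// enormsq_ge0.
Qed.

Lemma eq_enormsq u v : {in D, u =1 v} -> enormsq u = enormsq v.
Proof. by move=> uv; apply: eq_integral => x /uv ->. Qed.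

Lemma normsq_subrr u : normsq (fun x => u x - u x) = 0.
Proof.
rewrite /normsq (@eq_enormsq _ (fun=> 0)); last by move=> x _; rewrite subrr.
by rewrite /enormsq; under eq_integral do rewrite sqmod0 mul0r; rewrite integral0.
Qed.

Lemma le_enormsq u v : cmeasurable D u -> cmeasurable D v ->
  (forall x, D x -> sqmod (u x) <= sqmod (v x)) -> (enormsq u <= enormsq v)%E.
Proof.
move=> mu_ mv uv; apply: ge0_le_integral => //; [|exact: mdens..|].
  by move=> x Dx; exact: dens_ge0.
by move=> x Dx; rewrite lee_fin ler_wpM2r ?w0 ?uv.
Qed.

Lemma L2_le u v : cmeasurable D u -> L2 v ->
  (forall x, D x -> sqmod (u x) <= sqmod (v x)) -> L2 u.
Proof.
by move=> mu_ vL uv; split => //; exact: le_lt_trans (le_enormsq mu_ vL.1 uv) vL.2.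
Qed.

Lemma L2_integrable u : L2 u ->
  mu.-integrable D (fun x => (sqmod (u x) * w x)%:E).
Proof.
move=> [mu_ fu]; apply/integrableP; split; first exact: mdens.
rewrite (eq_integral (fun x => (sqmod (u x) * w x)%:E))// => x.
by rewrite inE => Dx; rewrite gee0_abs// dens_ge0.
Qed.

Lemma enormsqZ c u : cmeasurable D u ->
  enormsq (fun x => c * u x) = ((sqmod c)%:E * enormsq u)%E.
Proof.
move=> mu_; rewrite /enormsq -ge0_integralZl//; last 3 first.
- exact: mdens.
- by move=> x Dx; exact: dens_ge0.
- by rewrite lee_fin sqmod_ge0.
by apply: eq_integral => x _; rewrite sqmodM -EFinM mulrA.
Qed.

Lemma enormsqD_le u v : cmeasurable D u -> cmeasurable D v ->
  (enormsq (fun x => u x + v x)%R <= 2%:E * enormsq u + 2%:E * enormsq v)%E.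
Proof.
move=> mu_ mv; rewrite /enormsq -!ge0_integralZl//; last 4 first.
- exact: mdens.
- by move=> x Dx; exact: dens_ge0.
- exact: mdens.
- by move=> x Dx; exact: dens_ge0.
rewrite -ge0_integralD//; last 4 first.
- by move=> x Dx; rewrite mule_ge0// dens_ge0.
- by apply: measurable_funeM; exact: mdens.
- by move=> x Dx; rewrite mule_ge0// dens_ge0.
- by apply: measurable_funeM; exact: mdens.
apply: ge0_le_integral => //.
- by move=> x Dx; exact: (dens_ge0 (fun x => u x + v x)).
- by apply: mdens; exact: cmeasurableD.
- by apply: emeasurable_funD; apply: measurable_funeM; exact: mdens.
move=> x Dx; rewrite -!EFinM -EFinD lee_fin !mulrA -mulrDl.
by rewrite ler_wpM2r ?w0// sqmodD_le.
Qed.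

Lemma L2D u v : L2 u -> L2 v -> L2 (fun x => u x + v x).
Proof.
move=> uL vL; split; first exact: cmeasurableD uL.1 vL.1.
apply: le_lt_trans (enormsqD_le uL.1 vL.1) _.
by rewrite !enormsqE// -!EFinM -EFinD ltry.
Qed.

Lemma L2Z c u : L2 u -> L2 (fun x => c * u x).
Proof.
move=> uL; split; first exact: cmeasurableM (cmeasurable_cst _ c) uL.1.
by rewrite enormsqZ ?enormsqE ?ltry//; exact: uL.1.
Qed.

Lemma L2B u v : L2 u -> L2 v -> L2 (fun x => u x - v x).
Proof.
move=> uL vL; have := L2D uL (L2Z (-1) vL).
by under eq_fun do rewrite mulN1r.
Qed.

Lemma L2_cst0 : L2 (fun=> 0).
Proof.
split; first exact: cmeasurable_cst.
rewrite /enormsq; under eq_integral do rewrite sqmod0 mul0r.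
by rewrite integral0.
Qed.

Lemma L2_sum (I : eqType) (s : seq I) (c : I -> R[i]) (u : I -> T -> R[i]) :
  (forall i, i \in s -> L2 (u i)) -> L2 (fun x => \sum_(i <- s) c i * u i x).
Proof.
elim: s => [|i s IH] us.
  by under eq_fun do rewrite big_nil; exact: L2_cst0.
under eq_fun do rewrite big_cons; apply: L2D.
  by apply: L2Z; apply: us; rewrite mem_head.
by apply: IH => j js; apply: us; rewrite in_cons js orbT.
Qed.

Lemma normsqZ c u : L2 u -> normsq (fun x => c * u x) = sqmod c * normsq u.
Proof.
by move=> uL; rewrite /normsq enormsqZ ?enormsqE//; exact: uL.1.
Qed.

Lemma normsqD_le u v : L2 u -> L2 v ->
  normsq (fun x => u x + v x) <= 2 * normsq u + 2 * normsq v.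
Proof.
move=> uL vL; have := enormsqD_le uL.1 vL.1.
by rewrite (enormsqE (L2D uL vL)) !enormsqE// -!EFinM -EFinD lee_fin.
Qed.

Lemma normsqBC u v : normsq (fun x => u x - v x) = normsq (fun x => v x - u x).
Proof.
by rewrite /normsq; congr fine; apply: eq_integral => x _; rewrite sqmodB.
Qed.

Lemma inner_integrable u v : L2 u -> L2 v ->
  cintegrable mu D (fun x => u x * conjc (v x) * (w x)%:C).
Proof.
move=> uL vL.
have [m1 m2] : cmeasurable D (fun x => u x * conjc (v x) * (w x)%:C).
  by apply: cmeasurableM; [apply: cmeasurableM; [exact: uL.1|
    apply: cmeasurableJ; exact: vL.1] | exact: cmeasurableC].
have iuv := integrableD mD (L2_integrable uL) (L2_integrable vL).
split; apply: (le_integrable mD _ _ iuv).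
- exact/measurable_EFinP.
- move=> x Dx; rewrite /= lee_fin [leRHS]ger0_norm; last first.
    by rewrite addr_ge0// mulr_ge0 ?sqmod_ge0 ?w0.
  have -> : complex.Re (u x * conjc (v x) * (w x)%:C) =
      complex.Re (u x * conjc (v x)) * w x.
    by case: (u x * _) => a b /=; ring.
  by rewrite normrM (ger0_norm (w0 Dx)) -mulrDl ler_wpM2r ?w0 ?ReMJ_le.
- exact/measurable_EFinP.
- move=> x Dx; rewrite /= lee_fin [leRHS]ger0_norm; last first.
    by rewrite addr_ge0// mulr_ge0 ?sqmod_ge0 ?w0.
  have -> : complex.Im (u x * conjc (v x) * (w x)%:C) =
      complex.Im (u x * conjc (v x)) * w x.
    by case: (u x * _) => a b /=; ring.
  by rewrite normrM (ger0_norm (w0 Dx)) -mulrDl ler_wpM2r ?w0 ?ImMJ_le.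
Qed.

Lemma innerDl u1 u2 v : L2 u1 -> L2 u2 -> L2 v ->
  inner (fun x => u1 x + u2 x) v = inner u1 v + inner u2 v.
Proof.
move=> u1L u2L vL; rewrite /inner -cintegralD//; [|exact: inner_integrable..].
by apply: eq_cintegral => x _; rewrite !mulrDl.
Qed.

Lemma innerZl c u v : L2 u -> L2 v -> inner (fun x => c * u x) v = c * inner u v.
Proof.
move=> uL vL; rewrite /inner -cintegralZ//; last exact: inner_integrable.
by apply: eq_cintegral => x _; rewrite !mulrA.
Qed.

Lemma innerJ u v : L2 u -> L2 v -> inner v u = conjc (inner u v).
Proof.
move=> uL vL; rewrite /inner -cintegralJ//; last exact: inner_integrable.
apply: eq_cintegral => x _; rewrite !conjcM conjcK conjc_real.
by rewrite (mulrC (v x)).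
Qed.

Lemma innerBl u1 u2 v : L2 u1 -> L2 u2 -> L2 v ->
  inner (fun x => u1 x - u2 x) v = inner u1 v - inner u2 v.
Proof.
move=> u1L u2L vL; have := innerDl u1L (L2Z (-1) u2L) vL.
by rewrite innerZl// mulN1r; under eq_fun do rewrite mulN1r.
Qed.

Lemma innerDr u v1 v2 : L2 u -> L2 v1 -> L2 v2 ->
  inner u (fun x => v1 x + v2 x) = inner u v1 + inner u v2.
Proof.
move=> uL v1L v2L; have v12 := L2D v1L v2L.
rewrite (innerJ v12 uL) innerDl// rmorphD/=.
by rewrite (innerJ v1L uL) (innerJ v2L uL).
Qed.

Lemma innerZr c u v : L2 u -> L2 v ->
  inner u (fun x => c * v x) = conjc c * inner u v.
Proof.
move=> uL vL; rewrite (innerJ (L2Z c vL) uL) innerZl// conjcM.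
by rewrite (innerJ vL uL).
Qed.

Lemma inner0l v : inner (fun=> 0) v = 0.
Proof.
rewrite /inner (@eq_cintegral _ _ _ _ _ _ (fun=> (0 : R)%:C)).
  by rewrite (cintegral_ofreal _ mD) Rintegral_cst// mul0r.
by move=> x _; rewrite !mul0r.
Qed.

Lemma inner_suml (I : eqType) (s : seq I) (c : I -> R[i]) (u : I -> T -> R[i]) v :
  (forall i, i \in s -> L2 (u i)) -> L2 v ->
  inner (fun x => \sum_(i <- s) c i * u i x) v = \sum_(i <- s) c i * inner (u i) v.
Proof.
move=> us vL; elim: s us => [|i s IH] us.
  by under eq_fun do rewrite big_nil; rewrite big_nil inner0l.
under eq_fun do rewrite big_cons.
have uiL : L2 (u i) by apply: us; rewrite mem_head.
have usL j : j \in s -> L2 (u j) by move=> js; apply: us; rewrite in_cons js orbT.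
by rewrite innerDl ?innerZl ?big_cons ?IH//; [exact: L2Z | exact: L2_sum].
Qed.

Lemma inner_sumr (I : eqType) (s : seq I) (c : I -> R[i]) (v : I -> T -> R[i]) u :
  (forall i, i \in s -> L2 (v i)) -> L2 u ->
  inner u (fun x => \sum_(i <- s) c i * v i x) =
  \sum_(i <- s) conjc (c i) * inner u (v i).
Proof.
move=> vs uL; rewrite (innerJ (L2_sum c vs) uL) inner_suml// rmorph_sum/=.
rewrite !big_seq; apply: eq_bigr => i si.
by rewrite conjcM (innerJ (vs i si) uL).
Qed.

Lemma inner_normsq u : inner u u = (normsq u)%:C.
Proof.
rewrite /inner (@eq_cintegral _ _ _ _ _ _ (fun x => (sqmod (u x) * w x)%:C)).
  by rewrite cintegral_ofreal.
by move=> x _; rewrite mulcJ_sqmod -rmorphM.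
Qed.

Lemma normsqD u v : L2 u -> L2 v -> normsq (fun x => u x + v x) =
  normsq u + normsq v + 2 * complex.Re (inner u v).
Proof.
move=> uL vL; have := inner_normsq (fun x => u x + v x).
rewrite innerDl ?innerDr//; last exact: L2D.
rewrite !inner_normsq (innerJ uL vL); case: (inner u v) => a b /=.
by move=> /(congr1 (@complex.Re _)) /= <-; ring.
Qed.

Lemma normsqB u v : L2 u -> L2 v -> normsq (fun x => u x - v x) =
  normsq u + normsq v - 2 * complex.Re (inner u v).
Proof.
move=> uL vL; have := normsqD uL (L2Z (-1) vL); rewrite normsqZ// innerZr//.
under eq_fun do rewrite mulN1r.
by move=> ->; case: (inner u v) => a b; rewrite /sqmod /=; ring.
Qed.

Lemma cauchy_schwarz u v : L2 u -> L2 v ->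
  sqmod (inner u v) <= normsq u * normsq v.
Proof.
move=> uL vL; set c := inner u v.
(* The squared norm of u - t c v is nonnegative for real t; the factor c turns the cross term into t
   |c|^2. *)
have H (t : R) : 0 <= normsq u + t ^+ 2 * sqmod c * normsq v - 2 * (t * sqmod c).
  have := normsq_ge0 (fun x => u x - (t%:C * c) * v x).
  rewrite normsqB ?normsqZ ?innerZr//; [|exact: L2Z..].
  have -> : conjc (t%:C * c) * inner u v = (t * sqmod c)%:C.
    by rewrite conjcM conjc_real rmorphM/= -mulcJ_sqmod (mulrC c) mulrA.
  by rewrite sqmodM sqmodC.
have := normsq_ge0 v; rewrite le_eqVlt => /orP[/eqP v0|v0].
  (* When v has norm 0 and c is not 0, this t gives |u|^2 - 2 (|u|^2 + 1) >= 0, which is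
     impossible. *)
  rewrite -v0 mulr0; have := H ((normsq u + 1) / (sqmod c)); rewrite -v0 mulr0 addr0.
  have := sqmod_ge0 c; rewrite le_eqVlt => /orP[/eqP <-//|c0].
  by rewrite divfK ?gt_eqF//; have := normsq_ge0 u; lra.
(* The value of t that minimizes the quadratic in [H]. *)
have := H (normsq v)^-1; rewrite expr2.
have -> : (normsq v)^-1 * (normsq v)^-1 * sqmod c * normsq v = sqmod c / normsq v.
  by field; rewrite gt_eqF.
rewrite (mulrC _^-1) => H'.
have : sqmod c / normsq v <= normsq u by lra.
by rewrite ler_pdivrMr.
Qed.

End WeightedL2.

Arguments L2 {d T R}.
Arguments enormsq {d T R}.
Arguments normsq {d T R}.
Arguments inner {d T R}.

Import HBNNSimple.

(** * Closures in L_2, and reduction of density to indicators *)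

Section Approximation.
Context {d} {T : measurableType d} {R : realType}.
Variables (mu : {measure set T -> \bar R}) (D : set T) (w : T -> R).
Hypothesis mD : measurable D.
Hypothesis mw : measurable_fun D w.
Hypothesis w0 : forall x, D x -> 0 <= w x.
Implicit Types (u v : T -> R[i]) (c : R[i]) (A : set T).

Local Notation L2 := (L2 mu D w).
Local Notation normsq := (normsq mu D w).
Local Notation enormsq := (enormsq mu D w).

Lemma normsqB_le u v z : L2 u -> L2 v -> L2 z ->
  normsq (fun x => u x - z x) <=
  2 * normsq (fun x => u x - v x) + 2 * normsq (fun x => v x - z x).
Proof.
move=> uL vL zL; apply: le_trans (normsqD_le mD mw w0 (L2B mD mw w0 uL vL)
  (L2B mD mw w0 vL zL)).
by under [X in _ <= normsq X]eq_fun do rewrite addrA subrK.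
Qed.

Lemma enormsq_ae u v : cmeasurable D u -> cmeasurable D v ->
  {ae mu, forall x, D x -> u x = v x} -> enormsq u = enormsq v.
Proof.
move=> mu_ mv uv; apply: ge0_ae_eq_integral => //.
- by apply/measurable_EFinP; apply: measurable_funM => //; exact: measurable_sqmod.
- by apply/measurable_EFinP; apply: measurable_funM => //; exact: measurable_sqmod.
- by move=> x Dx; rewrite lee_fin mulr_ge0 ?sqmod_ge0 ?w0.
- by move=> x Dx; rewrite lee_fin mulr_ge0 ?sqmod_ge0 ?w0.
- by apply: filterS uv => x uvx Dx; rewrite uvx.
Qed.

Lemma enormsq_dct (u_ : nat -> T -> R[i]) u (G : T -> R) :
  (forall n, cmeasurable D (u_ n)) -> cmeasurable D u ->
  mu.-integrable D (EFin \o (fun x => G x * w x)) ->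
  (forall n x, D x -> sqmod (u x - u_ n x) <= G x) ->
  (forall x, D x -> (fun n => sqmod (u x - u_ n x)) @ \oo --> 0) ->
  (fun n => enormsq (fun x => u x - u_ n x)) @ \oo --> 0%E.
Proof.
move=> mu_ mu' iG leG cu.
pose F n x : \bar R := (sqmod (u x - u_ n x) * w x)%:E.
have mF n : measurable_fun D (F n).
  apply/measurable_EFinP; apply: measurable_funM => //.
  by apply: measurable_sqmod; exact: cmeasurableB.
have [] := dominated_convergence mD mF (f := fun=> 0%E) _ _ iG _.
- exact: measurable_cst.
- apply: aeW => x Dx; rewrite /F.
  apply: cvg_EFin; first by near=> n.
  rewrite -(mul0r (w x)); apply: cvgMl.
  exact: cu.
- apply: aeW => x n Dx; rewrite /F lee_fin ger0_norm; last first.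
    by rewrite mulr_ge0 ?sqmod_ge0 ?w0.
  by rewrite ler_wpM2r ?w0 ?leG.
by move=> _ _; rewrite integral0.
Unshelve. all: by end_near. Qed.

Variable S : (T -> R[i]) -> Prop.

(** Membership in the closure of [S] in L_2. [S] is later the set of trigonometric polynomials or
    the set of simple functions. *)
Definition approximable u : Prop :=
  L2 u /\ forall e : R, 0 < e ->
  exists v, [/\ S v, L2 v & normsq (fun x => u x - v x) < e].

Lemma approximable_closed u : L2 u ->
  (forall e : R, 0 < e -> exists v, approximable v /\
    normsq (fun x => u x - v x) < e) -> approximable u.
Proof.
move=> uL H; split => // e e0.
have e4 : 0 < e / 4 by rewrite divr_gt0.
have [v [[vL Hv] uv]] := H _ e4; have [z [Sz zL vz]] := Hv _ e4.
exists z; split => //; apply: le_lt_trans (normsqB_le uL vL zL) _.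
by lra.
Qed.

Lemma approximable_ae u v : cmeasurable D v ->
  {ae mu, forall x, D x -> u x = v x} -> approximable u -> approximable v.
Proof.
move=> mv uv [uL Hu].
have vL : L2 v by split=> //; rewrite -(enormsq_ae uL.1 mv uv); exact: uL.2.
split=> // e e0; have [z [Sz zL uz]] := Hu _ e0; exists z; split => //.
rewrite /normsq -(@enormsq_ae (fun x => u x - z x))//.
- by apply: cmeasurableB; [exact: uL.1 | exact: zL.1].
- by apply: cmeasurableB; [exact: vL.1 | exact: zL.1].
- by apply: filterS uv => x uvx Dx; rewrite uvx.
Qed.

Lemma approximable_eq u v : {in D, u =1 v} -> approximable u -> approximable v.
Proof.
move=> uv uA; apply: approximable_ae (uA).
  have [m1 m2] := uA.1.1; split.
  - by apply: eq_measurable_fun m1 => x Dx; rewrite uv.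
  - by apply: eq_measurable_fun m2 => x Dx; rewrite uv.
by apply: aeW => x Dx; rewrite uv// inE.
Qed.

Lemma approximable_dct (u_ : nat -> T -> R[i]) u (G : T -> R) :
  (forall n, approximable (u_ n)) -> L2 u ->
  mu.-integrable D (EFin \o (fun x => G x * w x)) ->
  (forall n x, D x -> sqmod (u x - u_ n x) <= G x) ->
  (forall x, D x -> (fun n => sqmod (u x - u_ n x)) @ \oo --> 0) ->
  approximable u.
Proof.
move=> Au uL iG leG cu; apply: approximable_closed => // e e0.
have := enormsq_dct (fun n => (Au n).1.1) uL.1 iG leG cu.
move=> /(@fine_cvgP _ _ \oo)[_] /cvgrPdist_lt /(_ _ e0)[n _ /(_ n (leqnn n))].
rewrite /= sub0r normrN => H; exists (u_ n); split => //.
exact: le_lt_trans (ler_norm _) H.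
Qed.

Hypothesis SD : forall u v, S u -> S v -> S (fun x => u x + v x).
Hypothesis SZ : forall c u, S u -> S (fun x => c * u x).

Lemma approximableD u v : approximable u -> approximable v ->
  approximable (fun x => u x + v x).
Proof.
move=> [uL Hu] [vL Hv]; split; first exact: L2D.
move=> e e0; have e4 : 0 < e / 4 by rewrite divr_gt0.
have [u' [Su u'L uu']] := Hu _ e4; have [v' [Sv v'L vv']] := Hv _ e4.
exists (fun x => u' x + v' x); split; [exact: SD|exact: L2D|].
under eq_fun do rewrite opprD addrACA.
apply: le_lt_trans (normsqD_le mD mw w0 _ _) _; [exact: L2B..|].
by lra.
Qed.

Lemma approximableZ c u : approximable u -> approximable (fun x => c * u x).
Proof.
move=> [uL Hu]; split; first exact: L2Z.
move=> e e0; have c1 : 0 < sqmod c + 1 by have := sqmod_ge0 c; lra.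
have [u' [Su u'L uu']] := Hu _ (divr_gt0 e0 c1).
exists (fun x => c * u' x); split; [exact: SZ|exact: L2Z|].
under eq_fun do rewrite -mulrBr.
rewrite normsqZ//; last exact: L2B.
move: uu'; rewrite ltr_pdivlMr// => H; apply: le_lt_trans H.
rewrite mulrC ler_wpM2l ?normsq_ge0//; lra.
Qed.

Lemma approximableB u v : approximable u -> approximable v ->
  approximable (fun x => u x - v x).
Proof.
move=> uA vA; have := approximableD uA (approximableZ (-1) vA).
by under eq_fun do rewrite mulN1r.
Qed.

Lemma approximable0 u : approximable u -> approximable (fun=> 0).
Proof. by move=> /(approximableZ 0); under eq_fun do rewrite mul0r. Qed.

(** The only input about [S] besides linearity. Monotone limits of simple functions, positive and
    negative parts, and real and imaginary parts then reach all of L_2. *)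
Hypothesis approximable_indic :
  forall A, measurable A -> A `<=` D -> approximable (fun x => (\1_A x)%:C).

Lemma approximable_fimfun (phi : {nnsfun T >-> R}) :
  approximable (fun x => (phi x)%:C).
Proof.
(* The level sets are cut down to [D], since [approximable_indic] speaks only of subsets of [D]. *)
have E : {in D, (fun x => \sum_(y <- finmap.enum_fset (fset_set (range phi)))
    y%:C * (\1_(phi @^-1` [set y] `&` D) x)%:C) =1 (fun x => (phi x)%:C)}.
  move=> x xD /=; rewrite [in RHS]fimfunE fsbig_finite//= rmorph_sum/=.
  by apply: eq_bigr => y _; rewrite rmorphM/= !indicE in_setI xD andbT.
apply: (approximable_eq E).
elim: (finmap.enum_fset _) => [|y s IH].
  under eq_fun do rewrite big_nil; apply: approximable0.
  exact: (approximable_indic (measurable0 : measurable (set0 : set T))).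
under eq_fun do rewrite big_cons; apply: approximableD => //.
apply: approximableZ; apply: approximable_indic => //.
exact: measurableI.
Qed.

Lemma approximable_ge0 (r : T -> R) : (forall x, D x -> 0 <= r x) ->
  L2 (fun x => (r x)%:C) -> approximable (fun x => (r x)%:C).
Proof.
move=> r0 rL; have mr : measurable_fun D (EFin \o r) by exact/measurable_EFinP/rL.1.1.
have [phi [ndphi cphi]] := approximation mD mr (fun x Dx => r0 x Dx).
have cphi' x : D x -> (fun n => phi n x) @ \oo --> r x.
  by move=> Dx; exact: (fine_cvg (cphi x Dx)).
have le_phi n x : D x -> phi n x <= r x.
  move=> Dx; rewrite -(cvg_lim _ (cphi' x Dx))//.
  apply: (@nondecreasing_cvgn_le _ (fun n => phi n x)).
    by move=> i j ij; have /lefP := ndphi _ _ ij; apply.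
  by apply/cvg_ex; exists (r x); exact: cphi'.
(* From 0 <= phi_n <= r follows |r - phi_n|^2 <= r^2, which is integrable against the weight. *)
apply: (@approximable_dct (fun n x => (phi n x)%:C) _ (fun x => r x ^+ 2)) => //.
- by move=> n; exact: approximable_fimfun.
- have := L2_integrable mw w0 rL.
  by apply: eq_integrable => // x _ /=; rewrite sqmodC.
- move=> n x Dx; rewrite -rmorphB sqmodC.
  have p0 : 0 <= phi n x by [].
  have := le_phi n x Dx; have := r0 x Dx.
  by move=> h1 h2; rewrite ler_sqr ?nnegrE; lra.
- move=> x Dx; under eq_fun do rewrite -rmorphB sqmodC expr2.
  rewrite -(mul0r 0); apply: cvgM; rewrite -(subrr (r x));
    by apply: cvgB; [exact: cvg_cst | exact: cphi'].
Qed.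

Lemma approximable_real (r : T -> R) :
  L2 (fun x => (r x)%:C) -> approximable (fun x => (r x)%:C).
Proof.
move=> rL; have mr : measurable_fun D r := rL.1.1.
have part (s : T -> R) : measurable_fun D s -> (forall x, 0 <= s x) ->
    (forall x, s x <= `|r x|) -> approximable (fun x => (s x)%:C).
  move=> ms s0 sr; apply: approximable_ge0 => //.
  apply: (L2_le mD mw w0 (cmeasurableC ms) rL) => x _.
  by rewrite !sqmodC -(real_normK (num_real (r x))) ler_sqr ?nnegrE.
apply: (@approximable_eq (fun x => (r^\+ x)%:C - (r^\- x)%:C)).
  by move=> x _ /=; rewrite -rmorphB/= -{3}[r]funrposBneg.
apply: approximableB; apply: part.
- exact: measurable_funrpos.
- by move=> x; exact: funrpos_ge0.
- by move=> x; rewrite /funrpos ge_max ler_norm normr_ge0.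
- exact: measurable_funrneg.
- by move=> x; exact: funrneg_ge0.
- by move=> x; rewrite /funrneg ge_max -normrN ler_norm normr_ge0.
Qed.

Lemma approximable_L2 u : L2 u -> approximable u.
Proof.
move=> uL; have [m1 m2] := uL.1.
apply: (@approximable_eq
    (fun x => (complex.Re (u x))%:C + 'i * (complex.Im (u x))%:C)).
  by move=> x _; rewrite -complexE.
apply: approximableD; [|apply: approximableZ]; apply: approximable_real;
  apply: (L2_le mD mw w0 _ uL); (try exact: cmeasurableC) => x _;
  rewrite sqmodC /sqmod.
- by rewrite lerDl sqr_ge0.
- by rewrite lerDr sqr_ge0.
Qed.

End Approximation.

(** * Completeness of unweighted L_2 for rapidly converging sequences *)

Section Completeness.
Context {d} {T : measurableType d} {R : realType}.
Variables (mu : {measure set T -> \bar R}) (D : set T).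
Hypothesis mD : measurable D.

Let one (x : T) : R := 1.
Let m1 : measurable_fun D one. Proof. exact: measurable_cst. Qed.
Let one0 x : D x -> 0 <= one x. Proof. by []. Qed.

Local Notation L2 := (L2 mu D one).
Local Notation normsq := (normsq mu D one).
Local Notation enormsq := (enormsq mu D one).

Variables (X : nat -> T -> R[i]) (C : R).
Hypothesis XL : forall n, L2 (X n).
Hypothesis geometric_steps :
  forall n, normsq (fun x => X n.+1 x - X n x) <= C * 8%:R^-1 ^+ n.

Let step n x := X n.+1 x - X n x.
Let stepL n : L2 (step n). Proof. exact: (L2B mD m1 one0). Qed.
Let mstep n : cmeasurable D (step n). Proof. exact: (stepL n).1. Qed.

Let C0 : 0 <= C.
Proof.
have := geometric_steps 0; rewrite expr0 mulr1; apply: le_trans.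
exact: (normsq_ge0 _ one0).
Qed.

(** The factor 2^n is split off the rate 8^-n: the integrals of [g n] still decay like 4^-n, so [G]
    is finite almost everywhere, while finiteness of [G] is strong enough to make the increments
    summable pointwise. *)
Let g n x : \bar R := (2 ^+ n * sqmod (step n x))%:E.
Let G x : \bar R := (\sum_(n <oo) g n x)%E.

Let g0 n x : (0 <= g n x)%E.
Proof. by rewrite lee_fin mulr_ge0 ?exprn_ge0 ?sqmod_ge0. Qed.

Let mg n : measurable_fun D (g n).
Proof.
apply/measurable_EFinP; apply: measurable_funM; first exact: measurable_cst.
exact: measurable_sqmod.
Qed.

Let mG : measurable_fun D G.
Proof. by apply: ge0_emeasurable_sum. Qed.

Let int_g n : (\int[mu]_(x in D) g n x <= (C * 4^-1 ^+ n)%:E)%E.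
Proof.
have -> : (\int[mu]_(x in D) g n x = (2 ^+ n)%:E * enormsq (step n))%E.
  rewrite /enormsq -ge0_integralZl//.
  - by apply: eq_integral => x _; rewrite /g /one mulr1 EFinM.
  - apply/measurable_EFinP; apply: measurable_funM => //.
    exact: measurable_sqmod.
  - by move=> x _; rewrite lee_fin mulr_ge0 ?sqmod_ge0.
rewrite (enormsqE one0 (stepL n)) -EFinM lee_fin.
apply: le_trans (ler_wpM2l _ (geometric_steps n)) _; first exact: exprn_ge0.
have e : 2 * 8^-1 = 4^-1 :> R by field.
by rewrite mulrCA -exprMn e.
Qed.

Let int_G : (\int[mu]_(x in D) G x < +oo)%E.
Proof.
rewrite /G integral_nneseries//.
have le n : (\sum_(0 <= k < n) (C * 4^-1 ^+ k)%:E <= (C * 2)%:E)%E.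
  rewrite sumEFin lee_fin -mulr_sumr ler_wpM2l//.
  have -> : \sum_(0 <= k < n) (4^-1 : R) ^+ k = (1 - 4^-1 ^+ n) * (4 / 3).
    elim: n => [|n IH]; first by rewrite big_nil expr0 subrr mul0r.
    by rewrite big_nat_recr//= IH exprS; field.
  have : 0 <= (4^-1 : R) ^+ n by rewrite exprn_ge0.
  by lra.
apply: (@le_lt_trans _ _ (C * 2)%:E); last by rewrite ltry.
apply: lime_le.
  by apply: is_cvg_nneseries => n _ _; apply: integral_ge0 => x _; exact: g0.
apply: nearW => n; apply: le_trans (le n).
by apply: lee_sum => k _; exact: int_g.
Qed.

Let E := D `&` [set x | (G x < +oo)%E].

Let mE : measurable E.
Proof. by apply: emeasurable_fun_infty_o. Qed.

Let aeE : {ae mu, forall x, D x -> E x}.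
Proof.
have iG : mu.-integrable D G.
  apply/integrableP; split => //.
  rewrite (eq_integral G)// => x _; rewrite gee0_abs//.
  by apply: nneseries_ge0 => n _ _; exact: g0.
apply: filterS (integrable_ae mD iG) => x Gx Dx; split => //=.
by rewrite ltey_eq Gx.
Qed.

Let cvg_of_steps (r : nat -> R) x : E x ->
  (forall n, (r n.+1 - r n) ^+ 2 <= sqmod (step n x)) -> cvgn r.
Proof.
move=> [Dx Gx] rs.
have Gfin : G x \is a fin_num.
  by rewrite ge0_fin_numE//; apply: nneseries_ge0 => n _ _; exact: g0.
have -> : r = (fun n => r 0%N + series (fun k => r k.+1 - r k) n).
  by apply/funext => n; rewrite /series /= telescope_sumr// addrC subrK.
apply: is_cvgD; first exact: is_cvg_cst.
apply: normed_cvg; apply: nondecreasing_is_cvgn.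
  by apply: nondecreasing_series => k _ _; exact: normr_ge0.
exists (fine (G x) + 2) => _ [n _ <-]; rewrite /series /=.
(* The inequality a <= t a^2 + 1/t for t > 0, with t = 2^k: it bounds the increments by terms of [G]
   plus a geometric series. *)
have H k : `|r k.+1 - r k| <= 2 ^+ k * sqmod (step k x) + 2^-1 ^+ k.
  apply: (@le_trans _ _ (2 ^+ k * (r k.+1 - r k) ^+ 2 + 2^-1 ^+ k)); last first.
    by rewrite lerD2r ler_wpM2l// exprn_ge0.
  have k0 : 0 < (2 : R) ^+ k by rewrite exprn_gt0.
  rewrite exprVn; set t := 2 ^+ k in k0 *; set z := r k.+1 - r k.
  rewrite -(real_normK (num_real z)); have := normr_ge0 z; set a := `|z| => a0.
  rewrite -(ler_pM2l k0) mulrDr divff ?gt_eqF// mulrA -expr2 -exprMn.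
  by have := sqr_ge0 (t * a - 2^-1); lra.
apply: le_trans (ler_sum _ (fun k _ => H k)) _; rewrite big_split/=; apply: lerD.
  rewrite -lee_fin fineK// -sumEFin.
  by apply: nneseries_lim_ge => k *; exact: (g0 k x).
have -> : \sum_(0 <= k < n) (2^-1 : R) ^+ k = (1 - 2^-1 ^+ n) * 2.
  elim: n => [|n IH]; first by rewrite big_nil expr0 subrr mul0r.
  by rewrite big_nat_recr//= IH exprS; field.
have : 0 <= (2^-1 : R) ^+ n by rewrite exprn_ge0.
by lra.
Qed.

(** Truncation to [E] makes the sequence converge at every point of [D], so that the pointwise limit
    [Y] is measurable. *)
Let X' n x := X n x * (\1_E x)%:C.
Let Y x : R[i] := limn (fun n => complex.Re (X' n x)) +i*
                  limn (fun n => complex.Im (X' n x)).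

Let cvgY x : D x ->
  (fun n => complex.Re (X' n x)) @ \oo --> complex.Re (Y x) /\
  (fun n => complex.Im (X' n x)) @ \oo --> complex.Im (Y x).
Proof.
move=> Dx; rewrite /Y /=.
have [xE|xE] := pselect (E x); last first.
  have -> : (fun n => complex.Re (X' n x)) = fun=> 0.
    by apply/funext => n; rewrite /X' indicE memNset// mulr0.
  have -> : (fun n => complex.Im (X' n x)) = fun=> 0.
    by apply/funext => n; rewrite /X' indicE memNset// mulr0.
  by rewrite lim_cst//; split; exact: cvg_cst.
have eqX n : X' n x = X n x by rewrite /X' indicE mem_set// mulr1.
split; apply: (cvg_of_steps xE) => n; rewrite !eqX /step.
- by case: (X n.+1 x) (X n x) => a b [a' b']; rewrite /sqmod /= lerDl sqr_ge0.
- by case: (X n.+1 x) (X n x) => a b [a' b']; rewrite /sqmod /= lerDr sqr_ge0.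
Qed.

Let mX' n : cmeasurable D (X' n).
Proof.
apply: cmeasurableM; first exact: (XL n).1.
by apply: cmeasurableC; exact: measurable_indic.
Qed.

Let mY : cmeasurable D Y.
Proof.
split.
- apply: (@measurable_fun_cvg _ _ _ _ (fun n x => complex.Re (X' n x))).
    by move=> n; exact: (mX' n).1.
  by move=> x /cvgY[].
- apply: (@measurable_fun_cvg _ _ _ _ (fun n x => complex.Im (X' n x))).
    by move=> n; exact: (mX' n).2.
  by move=> x /cvgY[].
Qed.

(** The ratio 1/8 absorbs the factor 2 lost at each use of [normsqB_le]: 2 (4 C / 8) + 2 C = 3 C <=
    4 C. *)
Let tail_le n k :
  normsq (fun x => X (n + k)%N x - X n x) <= 4 * C * 8%:R^-1 ^+ n.
Proof.
have p0 m : 0 <= (8%:R^-1 : R) ^+ m by rewrite exprn_ge0.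
elim: k n => [|k IH] n.
  by rewrite addn0 normsq_subrr !mulr_ge0.
apply: le_trans (normsqB_le mD m1 one0 (XL _) (XL n.+1) (XL _)) _.
have := IH n.+1; rewrite addSnnS exprS; have := geometric_steps n.
have := mulr_ge0 C0 (p0 n); rewrite -/(8%:R); set q := _ ^+ n.
set A := normsq _; set B := normsq _.
by rewrite !mulrA; lra.
Qed.

(** Fatou's lemma in k carries the bound of [tail_le] to the pointwise limit. *)
Let enormsqY n : (enormsq (fun x => Y x - X n x)%R <= (4 * C * 8%:R^-1 ^+ n)%:E)%E.
Proof.
pose f k x : \bar R := (sqmod (X' (n + k)%N x - X n x) * one x)%:E.
have mf k : measurable_fun D (f k).
  apply/measurable_EFinP; apply: measurable_funM => //; apply: measurable_sqmod.
  by apply: cmeasurableB => //; exact: (XL n).1.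
have f0 k x : D x -> (0 <= f k x)%E.
  by move=> _; rewrite lee_fin mulr_ge0 ?sqmod_ge0.
have cf x : D x -> (fun k => f k x) @ \oo --> (sqmod (Y x - X n x) * one x)%:E.
  move=> Dx; apply: cvg_EFin; first exact: nearW.
  have [cre cim] := cvgY Dx; apply: cvgMl.
  have eqs (a b : R[i]) : sqmod (a - b) =
      (complex.Re a - complex.Re b) ^+ 2 + (complex.Im a - complex.Im b) ^+ 2.
    by case: a b => [? ?] [].
  rewrite /= eqs; under eq_fun do rewrite /= eqs.
  have sq (r : nat -> R) (l c : R) : r @ \oo --> l ->
      (fun k => (r (n + k)%N - c) ^+ 2) @ \oo --> (l - c) ^+ 2.
    move=> rl; have rl' : (fun k => r (n + k)%N) @ \oo --> l.
      have -> : (fun k => r (n + k)%N) = [sequence r (k + n)%N]_k.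
        by apply/funext => k; rewrite /= addnC.
      by rewrite cvg_shiftn.
    rewrite expr2; under eq_fun do rewrite expr2.
    by apply: cvgM; apply: cvgB => //; exact: cvg_cst.
  by apply: cvgD; [exact: (sq _ _ _ cre) | exact: (sq _ _ _ cim)].
have int_f k : (\int[mu]_(x in D) f k x <= (4 * C * 8%:R^-1 ^+ n)%:E)%E.
  have -> : (\int[mu]_(x in D) f k x)%E =
      enormsq (fun x => X (n + k)%N x - X n x)%R.
    apply: enormsq_ae => //.
    - by apply: cmeasurableB => //; exact: (XL n).1.
    - by apply: cmeasurableB; [exact: (XL _).1 | exact: (XL n).1].
    - apply: filterS aeE => x xE Dx; have {}xE := xE Dx.
      by rewrite /X' indicE mem_set// mulr1.
  by rewrite (enormsqE one0 (L2B mD m1 one0 (XL _) (XL _))) lee_fin tail_le.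
apply: (@le_trans _ _ (\int[mu]_(x in D) limn_einf (fun k => f k x))%E).
  rewrite /enormsq (eq_integral (fun x => limn_einf (fun k => f k x)))//.
  move=> x; rewrite inE => Dx; have := cf x Dx => c.
  by rewrite (is_cvg_limn_einfE (cvgP _ c)); apply/esym/cvg_lim.
apply: (le_trans (fatou mu mD mf f0)).
rewrite limn_einf_lim; apply: lime_le; first exact: is_cvg_einfs.
by apply: nearW => k; apply: le_trans (int_f k); apply: ereal_inf_lbound; exists k => /=.
Qed.

Lemma L2_complete : exists Z, L2 Z /\
  (fun n => enormsq (fun x => Z x - X n x)) @ \oo --> 0%E.
Proof.
exists Y; split.
  split => //; have : L2 (fun x => Y x - X 0%N x).
    split; first by apply: cmeasurableB => //; exact: (XL 0).1.
    by apply: le_lt_trans (enormsqY 0) _; rewrite ltry.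
  move=> /(L2D mD m1 one0) /(_ (XL 0)) [_].
  by under eq_fun do rewrite subrK.
apply: (@squeeze_cvge _ _ _ _ (fun=> 0%E) _
  (fun n => (4 * C * 8%:R^-1 ^+ n)%:E)); last 2 first.
- exact: cvg_cst.
- apply: cvg_EFin; first exact: nearW.
  have := @cvg_geometric R (4 * C) 8%:R^-1; apply.
  by rewrite ger0_norm// invf_lt1// ltr1n.
- apply: nearW => n; rewrite enormsqY andbT.
  exact: (enormsq_ge0 _ one0).
Qed.

End Completeness.

(** * Exponentials and trigonometric polynomials *)

Section Exponentials.
Context {R : realType}.
Implicit Types (x : R) (j k : int).

Lemma chi0 x : chi 0 x = 1.
Proof. by rewrite /chi /expi mul0r cos0 sin0. Qed.

Lemma chiD j k x : chi (j + k) x = chi j x * chi k x.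
Proof.
rewrite /chi /expi intrD mulrDl cosD sinD; apply/eqP; rewrite eq_complex /=.
by apply/andP; split; apply/eqP; ring.
Qed.

Lemma chiN j x : chi (- j) x = conjc (chi j x).
Proof. by rewrite /chi /expi mulrNz mulNr cosN sinN. Qed.

Lemma sqmod_chi j x : sqmod (chi j x) = 1.
Proof. by rewrite /sqmod /chi /= cos2Dsin2. Qed.

Lemma chi_nat (n : nat) x : chi n%:Z x = chi 1 x ^+ n.
Proof.
by elim: n => [|n IH]; [rewrite chi0 expr0 | rewrite exprS -IH intS chiD].
Qed.

Lemma chiMJ j k x : chi j x * conjc (chi k x) = chi (j - k) x.
Proof. by rewrite -chiN chiD. Qed.

Lemma cmeasurable_chi (D : set R) j : cmeasurable D (chi j).
Proof.
split; apply: measurable_funTS; apply: measurableT_comp.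
- by apply: continuous_measurable_fun; exact: continuous_cos.
- exact: mulrl_measurable.
- by apply: continuous_measurable_fun; exact: continuous_sin.
- exact: mulrl_measurable.
Qed.

(* The shift by [chi (- n)] allows negative frequencies. *)
Definition is_trigpoly (u : R -> R[i]) : Prop :=
  exists (n : nat) (p : {poly R[i]}),
    u = fun x => chi (- n%:Z) x * p.[chi 1 x].

Lemma is_trigpolyM u v : is_trigpoly u -> is_trigpoly v ->
  is_trigpoly (fun x => u x * v x).
Proof.
move=> [n [p ->]] [m [q ->]]; exists (n + m)%N, (p * q); apply/funext => x.
by rewrite PoszD opprD chiD hornerM mulrACA.
Qed.

Lemma is_trigpolyD u v : is_trigpoly u -> is_trigpoly v ->
  is_trigpoly (fun x => u x + v x).
Proof.
have cancel (n : nat) x : chi (- n%:Z) x * chi 1 x ^+ n = 1 :> R[i].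
  by rewrite -chi_nat -chiD addNr chi0.
move=> [n [p ->]] [m [q ->]]; exists (n + m)%N, (p * 'X^m + q * 'X^n).
apply/funext => x; rewrite PoszD opprD chiD hornerD !hornerM !hornerXn.
have := cancel n x; have := cancel m x.
set a := chi (- n%:Z) x; set b := chi (- m%:Z) x.
set c := _ ^+ n; set e := _ ^+ m => be ac.
transitivity (a * p.[chi 1 x] * (b * e) + b * q.[chi 1 x] * (a * c)).
  by rewrite be ac !mulr1.
by ring.
Qed.

Lemma is_trigpoly_cst (c : R[i]) : is_trigpoly (fun=> c).
Proof. by exists 0%N, c%:P; apply/funext => x; rewrite hornerC oppr0 chi0 mul1r. Qed.

Lemma is_trigpolyZ (c : R[i]) u : is_trigpoly u -> is_trigpoly (fun x => c * u x).
Proof. exact/is_trigpolyM/is_trigpoly_cst. Qed.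

Lemma is_trigpolyX u n : is_trigpoly u -> is_trigpoly (fun x => u x ^+ n).
Proof.
move=> ut; elim: n => [|n IH].
  by under eq_fun do rewrite expr0; exact: is_trigpoly_cst.
by under eq_fun do rewrite exprS; exact: is_trigpolyM.
Qed.

Lemma is_trigpolyBl (c : R[i]) u : is_trigpoly u -> is_trigpoly (fun x => c - u x).
Proof.
move=> ut; under eq_fun do rewrite -mulN1r.
by apply: is_trigpolyD; [exact: is_trigpoly_cst | exact: is_trigpolyZ].
Qed.

Lemma is_trigpoly_sin (b : R) : is_trigpoly (fun x => (sin (b - x))%:C).
Proof.
(* The coefficients of e^{-ix} and e^{ix} in (e^{i(b-x)} - e^{-i(b-x)}) / (2i). *)
exists 1%N, (((sin b / 2) +i* (- (cos b / 2)))%:P +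
  ((sin b / 2) +i* (cos b / 2))%:P * 'X^2).
apply/funext => x; rewrite hornerD hornerM !hornerC hornerXn -chi_nat mulrDr.
rewrite mulrCA -chiD chiN (_ : - 1%:Z + 2%:Z = 1)// sinB /chi /expi !mul1r.
apply/eqP; rewrite eq_complex /=; apply/andP.
by split; apply/eqP; field.
Qed.

Lemma is_trigpoly_bounded u : is_trigpoly u ->
  exists2 M : R, 0 <= M & forall x, sqmod (u x) <= M.
Proof.
move=> [n [p ->]]; elim/poly_ind: p => [|p c [M M0 IH]].
  by exists 0 => // x; rewrite horner0 mulr0 sqmod0.
exists (2 * M + 2 * sqmod c); first by rewrite addr_ge0 ?mulr_ge0 ?sqmod_ge0.
move=> x; rewrite sqmodM sqmod_chi mul1r hornerD hornerC hornerMX.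
apply: le_trans (sqmodD_le _ _) _; rewrite sqmodM sqmod_chi mulr1 lerD2r.
by have := IH x; rewrite sqmodM sqmod_chi mul1r; lra.
Qed.

Lemma cmeasurable_trigpoly (D : set R) u : is_trigpoly u -> cmeasurable D u.
Proof.
move=> [n [p ->]]; apply: cmeasurableM; first exact: cmeasurable_chi.
elim/poly_ind: p => [|p c IH].
  by under eq_fun do rewrite horner0; exact: cmeasurable_cst.
under eq_fun do rewrite hornerD hornerC hornerMX.
apply: cmeasurableD; last exact: cmeasurable_cst.
by apply: cmeasurableM => //; exact: cmeasurable_chi.
Qed.

(** Distinctness of the frequencies is recorded so that biorthogonality can later isolate a single
    coefficient. *)
Lemma trigpoly_sum u : is_trigpoly u ->
  exists (J : seq int) (c : int -> R[i]), uniq J /\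
    u = fun x => \sum_(j <- J) c j * chi j x.
Proof.
move=> [n [p ->]].
(* [absz] is harmless: j + n is a natural number for every j in the list. *)
exists [seq i%:Z - n%:Z | i <- iota 0 (size p)], (fun j => p`_(absz (j + n%:Z))).
split.
  rewrite map_inj_uniq ?iota_uniq// => i k /eqP.
  by rewrite (inj_eq (addIr _)) => /eqP[].
apply/funext => x; rewrite big_map horner_coef mulr_sumr.
rewrite -(big_mkord xpredT (fun i => chi (- n%:Z) x * (p`_i * chi 1 x ^+ i))).
rewrite /index_iota subn0; apply: eq_bigr => i _.
by rewrite subrK absz_nat -chi_nat mulrCA -chiD addrC.
Qed.

End Exponentials.

(** * Polynomials converging to a step function on [0, 1] *)

Section SteepPolynomial.
Context {R : realType}.
Implicit Types (y t : R).

Lemma bernoulli_ge y m : 0 <= y <= 1 -> 1 - m%:R * y <= (1 - y) ^+ m.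
Proof.
move=> /andP[y0 y1]; elim: m => [|m IH]; first by rewrite expr0 mul0r subr0.
have h : 0 <= 1 - y by rewrite subr_ge0.
rewrite exprS; apply: le_trans (ler_wpM2l h IH).
have := mulr_ge0 (mulr_ge0 (ler0n R m) y0) y0; rewrite -natr1.
by nra.
Qed.

(** The induction step is (1 - y) (1 + (m + 1) y) = 1 + m y - (m + 1) y^2 <= 1 + m y. *)
Lemma bernoulli_le y m : 0 <= y <= 1 -> (1 - y) ^+ m * (1 + m%:R * y) <= 1.
Proof.
move=> /andP[y0 y1]; elim: m => [|m IH].
  by rewrite expr0 mul0r addr0 mul1r.
have h : 0 <= (1 - y) ^+ m by rewrite exprn_ge0// subr_ge0.
apply: le_trans IH; rewrite exprSr -mulrA ler_wpM2l//.
have := mulr_ge0 (mulr_ge0 (ler0n R m) y0) y0; rewrite -natr1.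
by nra.
Qed.

(** With s the square root of r, n s^n <= 1 + s + ... + s^(n-1) <= 1 / (1 - s), hence n r^n <= s^n /
    (1 - s). *)
Lemma cvg_muln_expr r : 0 <= r < 1 -> (fun n => n%:R * r ^+ n : R) @ \oo --> 0.
Proof.
move=> /andP[r0 r1]; set s := Num.sqrt r.
have s0 : 0 <= s by exact: sqrtr_ge0.
have rE : r = s ^+ 2 by rewrite sqr_sqrtr.
have s1 : s < 1 by rewrite -(@ltr_pXn2r _ 2)// ?nnegrE// -rE expr1n.
have H n : n%:R * s ^+ n * (1 - s) <= 1 - s ^+ n.
  elim: n => [|n IH]; first by rewrite !mul0r expr0 subrr.
  have p0 : 0 <= s ^+ n.+1 by rewrite exprn_ge0.
  have p1 : s ^+ n.+1 <= 1 by rewrite exprn_ile1// ltW.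
  have := ler_wpM2l s0 IH; rewrite -natr1 !exprS in p0 p1 *.
  by nra.
apply: (@squeeze_cvgr _ _ _ _ (fun=> 0) (fun n => (1 - s)^-1 * s ^+ n)).
- apply: nearW => n; rewrite mulr_ge0 ?exprn_ge0//=.
  rewrite rE -exprM mulnC exprM expr2 mulrA ler_wpM2r ?exprn_ge0//.
  have d0 : 0 < 1 - s by rewrite subr_gt0.
  rewrite -(ler_pM2r d0) mulVf ?gt_eqF//; apply: le_trans (H n) _.
  by rewrite lerBlDr lerDl exprn_ge0.
- exact: cvg_cst.
- have := @cvg_geometric R (1 - s)^-1 s; apply.
  by rewrite ger0_norm.
Qed.

(** A polynomial in t of the kind used in elementary proofs of the Stone-Weierstrass theorem. For t
    < 1/2 it is at least 1 - n (2t)^n. For t >= 1/2 Bernoulli bounds (1 - t^n)^(2^n) by 1/2 only,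
    and the extra exponent n drives the limit to 0, the threshold included. *)
Definition steep (n : nat) t : R := (1 - t ^+ n) ^+ (2 ^ n * n).

Lemma steep_itv n t : 0 <= t <= 1 -> 0 <= steep n t <= 1.
Proof.
move=> /andP[t0 t1]; have a0 : 0 <= t ^+ n by rewrite exprn_ge0.
have a1 : t ^+ n <= 1 by rewrite exprn_ile1.
have b0 : 0 <= 1 - t ^+ n by rewrite subr_ge0.
by rewrite exprn_ge0//= exprn_ile1// lerBlDr lerDl.
Qed.

Lemma cvg_steep t : 0 <= t <= 1 ->
  (fun n => steep n t) @ \oo --> ((t < 2^-1)%R%:R : R).
Proof.
move=> t01; have /andP[t0 t1] := t01.
have tn n : 0 <= t ^+ n <= 1 by rewrite exprn_ge0// exprn_ile1.
have [th|th] := ltP t 2^-1.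
- have : (fun n => 1 - n%:R * (2 * t) ^+ n) @ \oo --> (1 : R).
    rewrite -[X in _ --> X](subr0 1); apply: cvgB; first exact: cvg_cst.
    by apply: cvg_muln_expr; apply/andP; split; lra.
  move=> h; apply: (@squeeze_cvgr _ _ _ _ _ (fun=> 1)) h _; last exact: cvg_cst.
  apply: nearW => n; have /andP[_ ->] := steep_itv n t01; rewrite andbT.
  apply: le_trans (bernoulli_ge _ (tn n)).
  by rewrite natrM natrX exprMn mulrA (mulrC (n%:R)).
- apply: (@squeeze_cvgr _ _ _ _ (fun=> 0) (fun n => 1 * 2^-1 ^+ n)).
  + apply: nearW => n; have /andP[-> _] := steep_itv n t01 => /=.
    rewrite mul1r /steep exprM lerXn2r// ?nnegrE.
    - by rewrite exprn_ge0// subr_ge0; have /andP[] := tn n.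
    - by rewrite invr_ge0.
    have := bernoulli_le (2 ^ n) (tn n); set z := (1 - _) ^+ _.
    have z0 : 0 <= z by rewrite exprn_ge0// subr_ge0; have /andP[] := tn n.
    have : 1 <= (2 ^ n)%:R * t ^+ n.
      by rewrite natrX -exprMn exprn_ege1//; lra.
    by nra.
  + exact: cvg_cst.
  + by have := @cvg_geometric R 1 2^-1; apply; rewrite ger0_norm; lra.
Qed.

End SteepPolynomial.

(** * Density of trigonometric polynomials in L_2(w) *)

Section TrigonometricDensity.
Context {R : realType}.
Local Notation mR := (measurableTypeR R).
Variable w : mR -> R.
Local Notation leb := (@lebesgue_measure R).
Local Notation D := (@circle R : set mR).
Hypothesis w0 : forall x, D x -> 0 <= w x.
Hypothesis iw : leb.-integrable D (EFin \o w).

Local Notation L2 := (L2 leb D w).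
Local Notation normsq := (normsq leb D w).
Local Notation trig_approx := (approximable leb D w is_trigpoly).
Local Notation ind A := (fun x : mR => (\1_A x)%:C).
Implicit Types (u v q z : mR -> R[i]) (A B : set mR).

Lemma measurable_circle : measurable D.
Proof. exact: measurable_itv. Qed.
Let mD := measurable_circle.

Let mw : measurable_fun D w.
Proof. by have /integrableP[/measurable_EFinP] := iw. Qed.

Let iM (M : R) : leb.-integrable D (EFin \o (fun x => M * w x)).
Proof.
have := integrableZl mD M iw; exact: eq_integrable.
Qed.

Lemma L2_bounded u (M : R) : cmeasurable D u ->
  (forall x, D x -> sqmod (u x) <= M) -> L2 u.
Proof.
move=> mu uM; split => //.
have /integrableP[_] := iM M; apply: le_lt_trans; apply: ge0_le_integral => //.
- by move=> x Dx; rewrite lee_fin mulr_ge0 ?sqmod_ge0 ?w0.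
- by apply/measurable_EFinP; apply: measurable_funM => //; exact: measurable_sqmod.
- apply: measurableT_comp => //; apply/measurable_EFinP.
  by apply: measurable_funM => //; exact: measurable_cst.
- move=> x Dx; rewrite /= lee_fin; apply: le_trans (ler_norm _).
  by rewrite ler_wpM2r ?w0 ?uM.
Qed.

Lemma L2_trigpoly u : is_trigpoly u -> L2 u.
Proof.
move=> ut; have [M _ uM] := is_trigpoly_bounded ut.
by apply: (@L2_bounded _ M) => //; exact: cmeasurable_trigpoly.
Qed.

Lemma L2_chi j : L2 (chi j).
Proof.
apply: (@L2_bounded _ 1); first exact: cmeasurable_chi.
by move=> x _; rewrite sqmod_chi.
Qed.

Let app_trig u : is_trigpoly u -> trig_approx u.
Proof.
move=> ut; have uL := L2_trigpoly ut; split => // e e0; exists u; split => //.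
by rewrite normsq_subrr.
Qed.

Let appB u v : trig_approx u -> trig_approx v -> trig_approx (fun x => u x - v x).
Proof. by apply: approximableB => //; [exact: is_trigpolyD | exact: is_trigpolyZ]. Qed.

(** Multiplication by a bounded trigonometric polynomial is continuous on L_2(w) and maps
    trigonometric polynomials to themselves. *)
Let app_mul_trig u q : trig_approx u -> is_trigpoly q ->
  trig_approx (fun x => u x * q x).
Proof.
move=> [uL Hu] qt; have [M M0 qM] := is_trigpoly_bounded qt.
have dens (v : mR -> R[i]) : cmeasurable D v ->
    (enormsq leb D w (fun x => v x * q x)%R <= M%:E * enormsq leb D w v)%E.
  move=> mv; rewrite /enormsq -ge0_integralZl//; last 2 first.
  - by apply/measurable_EFinP; apply: measurable_funM => //; exact: measurable_sqmod.
  - by move=> x Dx; rewrite lee_fin mulr_ge0 ?sqmod_ge0 ?w0.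
  apply: ge0_le_integral => //.
  - by move=> x Dx; rewrite lee_fin mulr_ge0 ?sqmod_ge0 ?w0.
  - apply/measurable_EFinP; apply: measurable_funM => //; apply: measurable_sqmod.
    by apply: cmeasurableM => //; exact: cmeasurable_trigpoly.
  - apply: measurable_funeM; apply/measurable_EFinP; apply: measurable_funM => //.
    exact: measurable_sqmod.
  - move=> x Dx; rewrite -EFinM lee_fin mulrA ler_wpM2r ?w0// sqmodM mulrC.
    by rewrite ler_wpM2r ?sqmod_ge0.
have mulL (v : mR -> R[i]) : L2 v -> L2 (fun x => v x * q x).
  move=> vL; split.
    by apply: cmeasurableM; [exact: vL.1 | exact: cmeasurable_trigpoly].
  apply: le_lt_trans (dens _ vL.1) _.
  by rewrite (enormsqE w0 vL) -EFinM ltry.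
split; first exact: mulL.
move=> e e0; have M1 : 0 < M + 1 by lra.
have [p [pt pL up]] := Hu _ (divr_gt0 e0 M1).
exists (fun x => p x * q x); split; [exact: is_trigpolyM|exact: mulL|].
have upL := L2B mD mw w0 uL pL.
have := dens _ upL.1; under eq_fun do rewrite mulrBl.
have upqL := L2B mD mw w0 (mulL _ uL) (mulL _ pL).
rewrite (enormsqE w0 upL) (enormsqE w0 upqL) -EFinM lee_fin.
move=> /le_lt_trans; apply; move: up; rewrite ltr_pdivlMr// => up.
apply: le_lt_trans up; rewrite mulrC ler_wpM2l ?(normsq_ge0 _ w0)//.
by lra.
Qed.

(** Replace v by a trigonometric polynomial q first: |u| <= 1 controls u (v - q), and u q falls
    under [app_mul_trig]. This gives intersections of good sets. *)
Let app_mul u v : trig_approx u -> trig_approx v ->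
  (forall x, sqmod (u x) <= 1) -> trig_approx (fun x => u x * v x).
Proof.
move=> uA vA u1; have [vL Hv] := vA.
have muv (z : mR -> R[i]) : L2 z -> cmeasurable D (fun x => u x * z x).
  by move=> zL; apply: cmeasurableM; [exact: uA.1.1 | exact: zL.1].
have le1 (z : mR -> R[i]) x : sqmod (u x * z x) <= sqmod (z x).
  by rewrite sqmodM -[leRHS]mul1r ler_wpM2r ?sqmod_ge0.
have uvL (z : mR -> R[i]) : L2 z -> L2 (fun x => u x * z x).
  by move=> zL; exact: (L2_le mD mw w0 (muv _ zL) zL).
apply: (approximable_closed mD mw w0 (uvL _ vL)) => e e0.
have [q [qt qL vq]] := Hv _ e0.
exists (fun x => u x * q x); split; first exact: app_mul_trig.
have vqL := L2B mD mw w0 vL qL; apply: le_lt_trans vq.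
have uvqL := uvL _ vqL; rewrite -lee_fin -(enormsqE w0 vqL).
under eq_fun do rewrite -mulrBr.
rewrite -(enormsqE w0 uvqL).
have H := @le_enormsq _ _ _ leb D w mD mw w0 _ _ uvqL.1 vqL.1.
by apply: H => x _; exact: (le1 (fun x => v x - q x)).
Qed.

(** These sets form a sigma-algebra, so only a family of generators has to be approximated by
    hand. *)
Let good (A : set mR) := measurable A /\ trig_approx (ind A).

Let goodC A : good A -> good (~` A).
Proof.
move=> [mA aA]; split; first exact: measurableC.
have := appB (app_trig (is_trigpoly_cst 1)) aA.
congr approximable; apply/funext => x.
by rewrite !indicE in_setC; case: (x \in A); rewrite ?subrr ?subr0.
Qed.

Let goodI A B : good A -> good B -> good (A `&` B).
Proof.
move=> [mA aA] [mB aB]; split; first exact: measurableI.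
have := app_mul aA aB; under [X in _ -> trig_approx X]eq_fun do rewrite indicI rmorphM.
apply => x; rewrite sqmodC indicE; case: (x \in A); by rewrite ?expr1n// expr0n ler01.
Qed.

Let goodU A B : good A -> good B -> good (A `|` B).
Proof.
move=> gA gB; rewrite -[A `|` B]setCK setCU.
by apply: goodC; apply: goodI; exact: goodC.
Qed.

Let good0 : good set0.
Proof.
split => //; have := app_trig (is_trigpoly_cst 0).
by congr approximable; apply/funext => x; rewrite indicE in_set0.
Qed.

Let indL2 A : measurable A -> L2 (ind A).
Proof.
move=> mA; apply: (@L2_bounded _ 1).
  by apply: cmeasurableC; exact: measurable_indic.
move=> x _; rewrite sqmodC indicE.
by case: (x \in A); rewrite ?expr1n// expr0n ler01.
Qed.

Let good_bigcup (A : nat -> set mR) : (forall n, good (A n)) -> good (\bigcup_n A n).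
Proof.
move=> gA; have mU : measurable (\bigcup_n A n).
  by apply: bigcupT_measurable => n; have [] := gA n.
split => //; pose B n := \big[setU/set0]_(i < n) A i.
have gB n : good (B n).
  elim: n => [|n IH]; first by rewrite /B big_ord0.
  by rewrite /B big_ord_recr /=; exact: goodU.
apply: (@approximable_dct _ _ _ leb D w mD mw w0 is_trigpoly
  (fun n => ind (B n)) _ (fun=> 1)).
- by move=> n; exact: (gB n).2.
- exact: indL2.
- exact: iM.
- move=> n x _; rewrite -rmorphB sqmodC !indicE.
  by case: (x \in _); case: (x \in _);
    rewrite ?subrr ?subr0 ?sub0r ?sqrrN ?expr1n// expr0n ler01.
(* At a fixed point the indicators of the finite unions are eventually equal to that of the whole
   union. *)
- move=> x Dx; apply: cvg_near_cst; have [xU|xU] := pselect ((\bigcup_n A n) x).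
    have [i _ Aix] := xU; near=> n; apply/eqP.
    have xB : B n x.
      rewrite /B -bigcup_mkord; exists i => //=; by near: n; exists i.+1.
    by rewrite !indicE !mem_set// subrr sqmod0.
  apply: nearW => n; apply/eqP.
  have xB : ~ B n x by rewrite /B -bigcup_mkord => -[i _ Ai]; apply: xU; exists i.
  by rewrite !indicE !memNset// subrr sqmod0.
Unshelve. all: by end_near. Qed.

(** The set is t < 1/2 for t = (1 - sin(b - x)) / 2, which has values in [0, 1]; the functions
    [steep n (t x)] are trigonometric polynomials converging pointwise to its indicator. *)
Let good_sin (b : R) : good [set x : R | 0 < sin (b - x)].
Proof.
set A := [set x | _].
have mA : measurable A.
  rewrite (_ : A = (fun x : R => sin (b - x)) @^-1` `]0, +oo[); last first.
    by apply/seteqP; split => x /=; rewrite in_itv/= andbT.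
  rewrite -[X in measurable X]setTI.
  suff : measurable_fun setT (fun x : R => sin (b - x)) by apply => //; exact: measurable_itv.
  apply: measurableT_comp; last exact: measurable_funB.
  by apply: continuous_measurable_fun; exact: continuous_sin.
split => //; pose t (x : R) : R := (1 - sin (b - x)) / 2.
have t01 x : 0 <= t x <= 1.
  have := sin_le1 (b - x); have := sin_geN1 (b - x); rewrite /t => *.
  by apply/andP; split; lra.
have tT : is_trigpoly (fun x => (t x)%:C).
  under eq_fun do rewrite /t rmorphM/= mulrC rmorphB.
  apply: is_trigpolyZ; apply: is_trigpolyBl; exact: is_trigpoly_sin.
apply: (@approximable_dct _ _ _ leb D w mD mw w0 is_trigpoly
  (fun n x => (steep n (t x))%:C) _ (fun=> 1)).
- move=> n; apply: app_trig; rewrite /steep.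
  under eq_fun do rewrite rmorphXn/= rmorphB/= rmorphXn/=.
  by apply: is_trigpolyX; apply: is_trigpolyBl; exact: is_trigpolyX.
- exact: indL2.
- exact: iM.
- move=> n x _; rewrite -rmorphB sqmodC indicE.
  have /andP[? ?] := steep_itv n (t01 x).
  by case: (x \in A) => /=; nra.
- move=> x _; have -> : ind A x = ((t x < 2^-1)%R%:R : R)%:C.
    rewrite indicE /t; congr ((_ : bool)%:R%:C).
    by apply/idP/idP; rewrite inE /A /=; lra.
  under eq_fun do rewrite -rmorphB sqmodC expr2.
  rewrite -(mul0r 0) -{1 2}(subrr ((t x < 2^-1)%R%:R : R)).
  by apply: cvgM; apply: cvgB; (try exact: cvg_cst); exact: cvg_steep.
Qed.

(** -pi and pi are one point of the circle, which trigonometric polynomials cannot separate but rays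
    can; the endpoints are discarded as a null set. *)
Lemma circle_ae : {ae leb, forall x : mR, D x -> - pi < (x : R) < pi}.
Proof.
exists ([set - pi] `|` [set pi]); split.
- by apply: measurableU; exact: measurable_set1.
- by rewrite measureU0//; exact: lebesgue_measure_set1.
- move=> x /= /not_implyP[]; rewrite /circle /= in_itv /= => /andP[h1 h2] h3.
  have [->|n1] := eqVneq x (- pi); first by left.
  have [->|n2] := eqVneq x pi; first by right.
  by exfalso; apply: h3; rewrite !lt_neqAle h1 h2 n2 eq_sym n1.
Qed.

Let good_ae A B : measurable B -> good A ->
  (forall x : R, - pi < x < pi -> A x <-> B x) -> good B.
Proof.
move=> mB [mA aA] AB; split => //.
apply: (@approximable_ae _ _ _ leb D w mD mw w0 is_trigpoly (ind A)) => //.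
  by apply: cmeasurableC; exact: measurable_indic.
apply: filterS circle_ae => x xpi Dx; rewrite !indicE; congr ((_ : bool)%:R%:C).
by apply/idP/idP; rewrite !inE => /(AB x (xpi Dx)).
Qed.

Let sin_neg (x : R) : - pi < x <= 0 -> sin x <= 0.
Proof.
move=> /andP[h1 h2]; rewrite -oppr_ge0 -sinN.
by apply: sin_ge0_pi; apply/andP; split; lra.
Qed.

(** On ]-pi, pi[ the condition sin(b - x) > 0 describes the half circle that ends at b. For b <= 0
    it may wrap past -pi, and intersecting with x < 0 removes the extra piece; for b > 0 it may miss
    points near -pi, and the union with x < 0 restores them. *)
Let good_ray b : good `]-oo, b[%classic.
Proof.
have mray : measurable (`]-oo, b[%classic : set R) by exact: measurable_itv.
have goodT : good setT by rewrite -setC0; exact: goodC.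
have [b1|b1] := leP b (- pi).
  apply: (good_ae mray good0) => x /andP[x1 x2] /=; rewrite in_itv /=.
  by split => // xb; lra.
have [b2|b2] := leP pi b.
  apply: (good_ae mray goodT) => x /andP[x1 x2] /=; rewrite in_itv /=.
  by split => // _; lra.
have s0 (x : R) : - pi < x < pi -> 0 < sin (0 - x) <-> x < 0.
  move=> /andP[x1 x2]; split => h.
    rewrite ltNge; apply/negP => x0.
    have : sin (0 - x) <= 0 by apply: sin_neg; apply/andP; split; lra.
    by lra.
  by apply: sin_gt0_pi; apply/andP; split; lra.
have [b3|b3] := leP b 0.
  apply: (good_ae mray (goodI (good_sin b) (good_sin 0))) => x xpi /=.
  rewrite in_itv /=; have /andP[x1 x2] := xpi; split.
    move=> [h /(s0 x xpi) x0]; rewrite ltNge; apply/negP => bx.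
    have : sin (b - x) <= 0 by apply: sin_neg; apply/andP; split; lra.
    by lra.
  move=> xb; split; last by apply/(s0 x xpi); lra.
  by apply: sin_gt0_pi; apply/andP; split; lra.
apply: (good_ae mray (goodU (good_sin b) (good_sin 0))) => x xpi /=.
rewrite in_itv /=; have /andP[x1 x2] := xpi; split.
  move=> [h|/(s0 x xpi)]; last by lra.
  rewrite ltNge; apply/negP => bx.
  have : sin (b - x) <= 0 by apply: sin_neg; apply/andP; split; lra.
  by lra.
move=> xb; have [x0|x0] := ltP x 0; [right; exact/(s0 x xpi)|left].
by apply: sin_gt0_pi; apply/andP; split; lra.
Qed.

Let good_measurable A : measurable A -> good A.
Proof.
move=> mA; have : (RGenInftyO.G (R:=R)).-sigma.-measurable A.
  by rewrite -RGenInftyO.measurableE.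
apply: (@smallest_sub _ _ _ good).
  split; [exact: good0|by move=> B gB; rewrite setTD; exact: goodC|].
  exact: good_bigcup.
by move=> _ [b ->]; exact: good_ray.
Qed.

Lemma trigpoly_dense u : L2 u -> trig_approx u.
Proof.
apply: approximable_L2 => //; [exact: is_trigpolyD|exact: is_trigpolyZ|].
by move=> A /good_measurable[].
Qed.

End TrigonometricDensity.

(** * Translation of the problem's norms and expectations into the weighted L_2 setting *)

Section Normalization.
Context {R : realType}.
Local Notation mR := (measurableTypeR R).
Local Notation leb := (@lebesgue_measure R).
Local Notation D := (@circle R : set mR).
Implicit Types (w f g : mR -> R) (u : mR -> R[i]).

(* With the weight [w / (2 pi)] the squared norm of [L_2(w)] becomes [enormsq]. *)
Definition density w : mR -> R := fun x => (2 * pi)^-1 * w x.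

Lemma pi2_gt0 : 0 < (2 * pi)^-1 :> R.
Proof. by rewrite invr_gt0 mulr_gt0// pi_gt0. Qed.

Lemma density_ge0 w : (forall x, D x -> 0 <= w x) ->
  forall x, D x -> 0 <= density w x.
Proof. by move=> w0 x Dx; rewrite mulr_ge0 ?w0// ltW// pi2_gt0. Qed.

Lemma measurable_density w : measurable_fun D w -> measurable_fun D (density w).
Proof. by move=> mw; apply: measurable_funM => //; exact: measurable_cst. Qed.

Lemma integrable_density w : leb.-integrable D (EFin \o w) ->
  leb.-integrable D (EFin \o density w).
Proof.
move=> iw; have := integrableZl measurable_circle (2 * pi)^-1 iw.
exact: eq_integrable measurable_circle _ _ _.
Qed.

Lemma L2normsqE w u : measurable_fun D w -> (forall x, D x -> 0 <= w x) ->
  cmeasurable D u -> L2normsq w u = enormsq leb D (density w) u.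
Proof.
move=> mw w0 mu; rewrite /L2normsq /enormsq -ge0_integralZl//.
- by apply: eq_integral => x _; rewrite -EFinM mulrCA.
- exact: measurable_circle.
- by apply/measurable_EFinP; apply: measurable_funM => //; exact: measurable_sqmod.
- by move=> x Dx; rewrite lee_fin mulr_ge0 ?sqmod_ge0 ?w0.
- by rewrite lee_fin ltW// pi2_gt0.
Qed.

Lemma inL2E w u : measurable_fun D w -> (forall x, D x -> 0 <= w x) ->
  inL2 w u <-> L2 leb D (density w) u.
Proof.
by move=> mw w0; split=> -[mu fu]; split => //; move: fu; rewrite L2normsqE.
Qed.

Lemma enormsq_densityD f g u : measurable_fun D f -> measurable_fun D g ->
  (forall x, D x -> 0 <= f x) -> (forall x, D x -> 0 <= g x) ->
  cmeasurable D u ->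
  enormsq leb D (density (fun x => f x + g x)) u =
  (enormsq leb D (density f) u + enormsq leb D (density g) u)%E.
Proof.
move=> mf mg f0 g0 mu; rewrite /enormsq -ge0_integralD//.
- by apply: eq_integral => x _; rewrite -EFinD /density mulrDr mulrDr.
- exact: measurable_circle.
- by move=> x Dx; rewrite lee_fin mulr_ge0 ?sqmod_ge0 ?density_ge0.
- apply/measurable_EFinP; apply: measurable_funM; first exact: measurable_sqmod.
  exact: measurable_density.
- by move=> x Dx; rewrite lee_fin mulr_ge0 ?sqmod_ge0 ?density_ge0.
- apply/measurable_EFinP; apply: measurable_funM; first exact: measurable_sqmod.
  exact: measurable_density.
Qed.

Context {d} {T : measurableType d} (P : probability T R).
Implicit Types X Y : T -> R[i].

Lemma mean_squareE X : mean_square P X = enormsq P setT (fun=> 1) X.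
Proof.
rewrite /mean_square expectation.unlock /enormsq.
by apply: eq_integral => x _; rewrite mulr1.
Qed.

Lemma second_orderE X : second_order P X <-> L2 P setT (fun=> 1) X.
Proof. by rewrite /second_order mean_squareE. Qed.

Lemma cexpectation_inner X Y :
  cexpectation P (fun t => X t * conjc (Y t)) = inner P setT (fun=> 1) X Y.
Proof. by apply: eq_cintegral => t _; rewrite mulr1. Qed.

End Normalization.

(** * Mean square stochastic integrals: linearity, boundedness and existence *)

Section StochasticIntegral.
Context {R : realType} {d} {T : measurableType d} (P : probability T R).
Local Notation mR := (measurableTypeR R).
Local Notation leb := (@lebesgue_measure R).
Local Notation D := (@circle R : set mR).
Local Notation L2P := (L2 P setT (fun=> 1)).
Local Notation normsqP := (normsq P setT (fun=> 1)).
Implicit Types (s : seq (R[i] * set R)) (Z : set R -> T -> R[i]) (c : R[i]).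

Let mT : measurable (setT : set T). Proof. exact: measurableT. Qed.
Let m1 : measurable_fun (setT : set T) (fun=> 1 : R). Proof. exact: measurable_cst. Qed.
Let one0 (t : T) : setT t -> 0 <= (fun=> 1 : R) t. Proof. by []. Qed.

Lemma simple_wf_mem s p : simple_wf s -> p \in s ->
  measurable (p.2 : set mR) /\ p.2 `<=` circle.
Proof. by move=> ws /(nthP (0, set0))[i si <-]; exact: ws. Qed.

Lemma simple_wf_cat s s' : simple_wf s -> simple_wf s' -> simple_wf (s ++ s').
Proof.
move=> ws ws' i; rewrite size_cat nth_cat => si; case: ltnP => [|ii].
  exact: ws.
by apply: ws'; rewrite ltn_subLR.
Qed.

Definition simple_scale c s := [seq (c * p.1, p.2) | p <- s].

Lemma simple_wf_scale c s : simple_wf s -> simple_wf (simple_scale c s).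
Proof.
move=> ws i; rewrite size_map => si.
by rewrite (nth_map (0, set0))//=; exact: ws.
Qed.

Lemma simple_fun_cat s s' x :
  simple_fun (s ++ s') x = simple_fun s x + simple_fun s' x.
Proof. by rewrite /simple_fun big_cat. Qed.

Lemma simple_integral_cat Z s s' t :
  simple_integral Z (s ++ s') t = simple_integral Z s t + simple_integral Z s' t.
Proof. by rewrite /simple_integral big_cat. Qed.

Lemma simple_fun_scale c s x : simple_fun (simple_scale c s) x = c * simple_fun s x.
Proof.
by rewrite /simple_fun big_map mulr_sumr; apply: eq_bigr => p _; rewrite mulrA.
Qed.

Lemma simple_integral_scale Z c s t :
  simple_integral Z (simple_scale c s) t = c * simple_integral Z s t.
Proof.
by rewrite /simple_integral big_map mulr_sumr; apply: eq_bigr => p _; rewrite mulrA.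
Qed.

Section Weight.
Variable w : mR -> R.
Hypothesis w0 : forall x, D x -> 0 <= w x.
Hypothesis iw : leb.-integrable D (EFin \o w).
Local Notation L2w := (L2 leb D (density w)).
Local Notation normsqw := (normsq leb D (density w)).

Lemma measurable_weight : measurable_fun D w.
Proof. by have /integrableP[/measurable_EFinP] := iw. Qed.

Let mD := @measurable_circle R.
Let dw0 := density_ge0 w0.
Let mdw := measurable_density measurable_weight.
Let idw := integrable_density iw.

Lemma L2_indic (A : set mR) : measurable A -> L2w (fun x => (\1_A x)%:C).
Proof.
move=> mA; apply: (@L2_bounded _ _ dw0 idw _ 1).
  by apply: cmeasurableC; exact: measurable_indic.
move=> x _; rewrite sqmodC indicE.
by case: (x \in A); rewrite ?expr1n// expr0n ler01.
Qed.

Lemma L2_simple s : simple_wf s -> L2w (simple_fun s).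
Proof.
move=> ws; apply: (L2_sum mD mdw dw0) => p /(simple_wf_mem ws)[mA _].
exact: L2_indic.
Qed.

Lemma simple_dense u e : L2w u -> 0 < e ->
  exists s, simple_wf s /\ normsqw (fun x => u x - simple_fun s x) < e.
Proof.
pose S (v : mR -> R[i]) := exists2 s, simple_wf s & v = simple_fun s.
have SD u1 u2 : S u1 -> S u2 -> S (fun x => u1 x + u2 x).
  move=> [s1 ws1 ->] [s2 ws2 ->]; exists (s1 ++ s2); first exact: simple_wf_cat.
  by apply/funext => x; rewrite simple_fun_cat.
have SZ c u1 : S u1 -> S (fun x => c * u1 x).
  move=> [s1 ws1 ->]; exists (simple_scale c s1); first exact: simple_wf_scale.
  by apply/funext => x; rewrite simple_fun_scale.
move=> uL e0; have [] := @approximable_L2 _ _ _ leb D (density w) mD mdw dw0 S SD SZ _ u uL.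
  move=> A mA AD; have AL := L2_indic mA; split => // e' e'0.
  have E : (fun x : mR => (\1_A x)%:C : R[i]) = simple_fun [:: (1, A)].
    by apply/funext => x; rewrite /simple_fun big_seq1 mul1r.
  exists (simple_fun [:: (1, A)]); split; [|by rewrite -E|].
    by exists [:: (1, A)] => // -[|//] _.
  by rewrite -E normsq_subrr.
by move=> _ /(_ e e0) [v [[s ws ->] _ us]]; exists s.
Qed.

Variables (Z : set R -> T -> R[i]) (K : R).
Hypothesis K0 : 0 <= K.
Hypothesis ZL : forall A : set mR, measurable A -> A `<=` circle -> L2P (Z A).
(** A bound rather than an isometry, so that the theory applies to [Zxi] and [Zeta] with [K = 1] and
    to their sum with [K = 2]. *)
Hypothesis Z_bounded : forall s, simple_wf s ->
  normsqP (simple_integral Z s) <= K * normsqw (simple_fun s).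

Lemma L2_simple_integral s : simple_wf s -> L2P (simple_integral Z s).
Proof.
by move=> ws; apply: (L2_sum mT m1 one0) => p /(simple_wf_mem ws)[mA AD]; exact: ZL.
Qed.

Lemma simple_integralB_le s s' : simple_wf s -> simple_wf s' ->
  normsqP (fun t => simple_integral Z s t - simple_integral Z s' t) <=
  K * normsqw (fun x => simple_fun s x - simple_fun s' x).
Proof.
move=> ws ws'; have := Z_bounded (simple_wf_cat ws (@simple_wf_scale (-1) _ ws')).
have -> : simple_integral Z (s ++ simple_scale (-1) s') =
    (fun t => simple_integral Z s t - simple_integral Z s' t).
  by apply/funext => t; rewrite simple_integral_cat simple_integral_scale mulN1r.
have -> // : simple_fun (s ++ simple_scale (-1) s') =
    (fun x => simple_fun s x - simple_fun s' x).
by apply/funext => x; rewrite simple_fun_cat simple_fun_scale mulN1r.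
Qed.

(** One simple function approximates the integrand and the integral at once, so that sums and
    multiples combine without handling sequences; [ms_integralP] is the equivalence with
    [stochastic_integral]. *)
Definition ms_integral (h : mR -> R[i]) (Y : T -> R[i]) : Prop :=
  [/\ L2w h, L2P Y & forall e : R, 0 < e -> exists s, [/\ simple_wf s,
     normsqw (fun x => h x - simple_fun s x) < e &
     normsqP (fun t => Y t - simple_integral Z s t) < e]].

Lemma ms_integral_bound h Y : ms_integral h Y -> normsqP Y <= 4 * K * normsqw h.
Proof.
move=> [hL YL H]; apply/ler_addgt0Pl => e e0.
(* With tolerance t, |Y|^2 <= 2 t + 2 K (2 t + 2 |h|^2); t = e / (2 + 4 K) leaves exactly e above 4
   K |h|^2. *)
have K1 : 0 < 2 + 4 * K by have := K0; lra.
have [s [ws hs Ys]] := H _ (divr_gt0 e0 K1).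
have sL := L2_simple ws; have sI := L2_simple_integral ws.
have h1 := normsqD_le mT m1 one0 (L2B mT m1 one0 YL sI) sI.
have h2 := normsqD_le mD mdw dw0 (L2B mD mdw dw0 sL hL) hL.
have subDK V (u v : V -> R[i]) : (fun x => u x - v x + v x) = u.
  by apply/funext => x; rewrite subrK.
rewrite subDK in h1; rewrite subDK in h2.
rewrite normsqBC in h2; have h3 := Z_bounded ws.
have h4 := ler_wpM2l K0 h2.
have h5 := ler_wpM2l K0 (ltW hs).
have h6 : e = 2 * (e / (2 + 4 * K)) + 4 * (K * (e / (2 + 4 * K))).
  by field; rewrite gt_eqF.
rewrite {1}h6; lra.
Qed.

Lemma ms_integralD h h' Y Y' : ms_integral h Y -> ms_integral h' Y' ->
  ms_integral (fun x => h x + h' x) (fun t => Y t + Y' t).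
Proof.
move=> [hL YL H] [hL' YL' H']; split; [exact: L2D|exact: L2D|].
move=> e e0; have e4 : 0 < e / 4 by rewrite divr_gt0.
have [s [ws hs Ys]] := H _ e4; have [s' [ws' hs' Ys']] := H' _ e4.
have sL := L2_simple ws; have sI := L2_simple_integral ws.
have sL' := L2_simple ws'; have sI' := L2_simple_integral ws'.
exists (s ++ s'); split; first exact: simple_wf_cat.
- under eq_fun do rewrite simple_fun_cat opprD addrACA.
  apply: le_lt_trans (normsqD_le mD mdw dw0 (L2B _ _ _ _ _) (L2B _ _ _ _ _)) _ => //.
  by lra.
- under [X in normsqP X]eq_fun do rewrite simple_integral_cat opprD addrACA.
  apply: le_lt_trans (normsqD_le mT m1 one0 (L2B _ _ _ _ _) (L2B _ _ _ _ _)) _ => //.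
  by lra.
Qed.

Lemma ms_integralZ c h Y : ms_integral h Y ->
  ms_integral (fun x => c * h x) (fun t => c * Y t).
Proof.
move=> [hL YL H]; split; [exact: L2Z|exact: L2Z|].
move=> e e0; have c1 : 0 < sqmod c + 1 by have := sqmod_ge0 c; lra.
have [s [ws hs Ys]] := H _ (divr_gt0 e0 c1).
have sL := L2_simple ws; have sI := L2_simple_integral ws.
have le z : 0 <= z -> z < e / (sqmod c + 1) -> sqmod c * z < e.
  move=> z0; rewrite ltr_pdivlMr// => lez; apply: le_lt_trans lez.
  by rewrite mulrC ler_wpM2l//; lra.
exists (simple_scale c s); split; first exact: simple_wf_scale.
- under eq_fun do rewrite simple_fun_scale -mulrBr.
  by rewrite normsqZ ?le ?normsq_ge0//; exact: L2B.
- under [X in normsqP X]eq_fun do rewrite simple_integral_scale -mulrBr.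
  by rewrite normsqZ ?le ?(normsq_ge0 _ one0)//; exact: L2B.
Qed.

Lemma ms_integral_simple s : simple_wf s ->
  ms_integral (simple_fun s) (simple_integral Z s).
Proof.
move=> ws; split; [exact: L2_simple|exact: L2_simple_integral|].
by move=> e e0; exists s; split; rewrite ?normsq_subrr.
Qed.

Lemma ms_integral_sum (I : Type) (J : seq I) (c : I -> R[i])
    (h : I -> mR -> R[i]) (Y : I -> T -> R[i]) :
  (forall j, ms_integral (h j) (Y j)) ->
  ms_integral (fun x => \sum_(j <- J) c j * h j x)
              (fun t => \sum_(j <- J) c j * Y j t).
Proof.
move=> H; elim: J => [|j J IH].
  have : ms_integral (simple_fun [::]) (simple_integral Z [::]).
    exact: ms_integral_simple.
  congr ms_integral; apply/funext => x.
  - by rewrite /simple_fun !big_nil.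
  - by rewrite /simple_integral !big_nil.
under eq_fun do rewrite big_cons; under [X in ms_integral _ X]eq_fun do rewrite big_cons.
by apply: ms_integralD => //; exact: ms_integralZ.
Qed.

Lemma ms_integralB h h' Y Y' : ms_integral h Y -> ms_integral h' Y' ->
  ms_integral (fun x => h x - h' x) (fun t => Y t - Y' t).
Proof.
move=> H /(ms_integralZ (-1)) /(ms_integralD H).
by under eq_fun do rewrite mulN1r; under [X in ms_integral _ X]eq_fun do rewrite mulN1r.
Qed.

(** Simple functions within 8^-n of h, in squared norm, have integrals whose consecutive differences
    are at most 4 K 8^-n: the rate that [L2_complete] asks for. *)
Lemma ms_integral_exists h : L2w h -> exists Y, ms_integral h Y.
Proof.
move=> hL; pose eps n : R := 8%:R^-1 ^+ n.
have eps0 n : 0 < eps n by rewrite exprn_gt0.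
have /choice[s Hs] : forall n, exists s, simple_wf s /\
    normsqw (fun x => h x - simple_fun s x) < eps n.
  by move=> n; exact: simple_dense.
have ws n : simple_wf (s n) by have [] := Hs n.
have hs n : normsqw (fun x => h x - simple_fun (s n) x) < eps n by have [] := Hs n.
have XL n := L2_simple_integral (ws n).
have steps n : normsqP (fun t => simple_integral Z (s n.+1) t -
    simple_integral Z (s n) t) <= K * 4 * 8%:R^-1 ^+ n.
  apply: le_trans (simple_integralB_le (ws _) (ws _)) _; rewrite -mulrA ler_wpM2l//.
  apply: le_trans (normsqB_le mD mdw dw0 (L2_simple (ws _)) hL (L2_simple (ws _))) _.
  rewrite [X in 2 * X + _]normsqBC.
  have := hs n; have := hs n.+1; rewrite /eps exprS.
  have := eps0 n; rewrite /eps; set q := _ ^+ n.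
  set A := normsq _ _ _ _; set B := normsq _ _ _ _; lra.
have [Y [YL cY]] := L2_complete mT XL steps.
exists Y; split => // e e0.
have : (fun n => normsqP (fun t => Y t - simple_integral Z (s n) t)) @ \oo --> 0.
  exact: (fine_cvg cY).
move=> /cvgrPdist_lt /(_ _ e0) H1.
have : eps @ \oo --> 0.
  have := @cvg_geometric R 1 8%:R^-1; rewrite /geometric /= => H.
  rewrite (_ : eps = fun n => 1 * 8%:R^-1 ^+ n); last first.
    by apply/funext => n; rewrite mul1r.
  by apply: H; rewrite ger0_norm// invf_lt1// ltr1n.
move=> /cvgrPdist_lt /(_ _ e0) H2.
have [n _ /(_ n (leqnn n))[h1 h2]] := filterI H1 H2.
exists (s n); split => //.
- apply: lt_trans (hs n) _; move: h2; rewrite sub0r normrN.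
  exact: le_lt_trans (ler_norm _).
- by move: h1; rewrite sub0r normrN; exact: le_lt_trans (ler_norm _).
Qed.

Lemma ms_integralP h Y : stochastic_integral P w Z h Y <-> ms_integral h Y.
Proof.
have mw := measurable_weight.
split.
- move=> [/(inL2E _ mw w0) hL /second_orderE YL [s [ws cs cY]]]; split => // e e0.
  have c1 : (fun n => normsqw (fun x => h x - simple_fun (s n) x)) @ \oo --> 0.
    apply: fine_cvg; apply: cvg_trans cs; apply: near_eq_cvg; apply: nearW => n.
    rewrite L2normsqE//; apply: cmeasurableB; first exact: hL.1.
    exact: (L2_simple (ws n)).1.
  have c2 : (fun n => normsqP (fun t => Y t - simple_integral Z (s n) t)) @ \oo --> 0.
    apply: fine_cvg; apply: cvg_trans cY; apply: near_eq_cvg; apply: nearW => n.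
    by rewrite mean_squareE.
  move: c1 c2 => /cvgrPdist_lt /(_ _ e0) H1 /cvgrPdist_lt /(_ _ e0) H2.
  have [n _ /(_ n (leqnn n))[h1 h2]] := filterI H1 H2.
  exists (s n); split => //.
  + by move: h1; rewrite sub0r normrN; exact: le_lt_trans (ler_norm _).
  + by move: h2; rewrite sub0r normrN; exact: le_lt_trans (ler_norm _).
- move=> [hL YL H]; split; [exact/(inL2E _ mw w0)|exact/second_orderE|].
  have /choice[s Hs] : forall n, exists s, [/\ simple_wf s,
     normsqw (fun x => h x - simple_fun s x) < n.+1%:R^-1 &
     normsqP (fun t => Y t - simple_integral Z s t) < n.+1%:R^-1].
    by move=> n; apply: H; rewrite invr_gt0.
  have ws n : simple_wf (s n) by have [] := Hs n.
  have lim0 (a : nat -> \bar R) : (forall n, (0 <= a n <= (n.+1%:R^-1)%:E)%E) ->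
      a @ \oo --> 0%E.
    move=> a0; apply: (@squeeze_cvge _ _ _ _ (fun=> 0%E) _ (fun n => (n.+1%:R^-1)%:E)).
    + by apply: nearW => n; exact: a0.
    + exact: cvg_cst.
    + by apply: cvg_EFin; [exact: nearW | exact: cvg_harmonic].
  exists s; split => //; apply: lim0 => n; have [_ h1 h2] := Hs n.
  + have hsL := L2B mD mdw dw0 hL (L2_simple (ws n)).
    rewrite L2normsqE//; last exact: hsL.1.
    by rewrite (enormsq_ge0 _ dw0)/= (enormsqE dw0 hsL) lee_fin ltW.
  + have YsL := L2B mT m1 one0 YL (L2_simple_integral (ws n)).
    rewrite mean_squareE.
    by rewrite (enormsq_ge0 _ one0)/= (enormsqE one0 YsL) lee_fin ltW.
Qed.

End Weight.
End StochasticIntegral.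

(** * Continuity of the squared norm, and transfer of norms between two spaces *)

Section InnerProducts.
Context {R : realType} {d} {T : measurableType d} {d'} {T' : measurableType d'}.
Variables (mu : {measure set T -> \bar R}) (D : set T) (w : T -> R).
Hypothesis mD : measurable D.
Hypothesis mw : measurable_fun D w.
Hypothesis w0 : forall x, D x -> 0 <= w x.
Implicit Types u v : T -> R[i].

Local Notation L2u := (L2 mu D w).
Local Notation nsq := (normsq mu D w).
Local Notation ip := (inner mu D w).

(** With z = u - v, the difference of the squared norms is 2 Re <u, z> - |z|^2, and Cauchy-Schwarz
    controls the cross term. *)
Lemma normsq_continuous u (e : R) : L2u u -> 0 < e -> exists2 r : R, 0 < r &
  forall v, L2u v -> nsq (fun x => u x - v x) < r -> `|nsq u - nsq v| < e.
Proof.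
move=> uL e0; set M := nsq u.
have M0 : 0 <= M := normsq_ge0 mu w0 u.
have M1 : 0 < 4 * (4 * M + 1) by lra.
(* The first bound handles |z|^2; the second gives (2 Re <u, z>)^2 <= 4 M |z|^2 < (e / 2)^2, and the
   added 1 keeps the denominator positive when M = 0. *)
exists (Num.min (e / 2) (e ^+ 2 / (4 * (4 * M + 1)))).
  by rewrite lt_min !divr_gt0// exprn_gt0.
move=> v vL; rewrite lt_min => /andP[h1]; rewrite ltr_pdivlMr// => h2.
have uvL := L2B mD mw w0 uL vL.
have -> : nsq v = nsq (fun x => u x - (u x - v x)).
  by congr normsq; apply/funext => x; rewrite opprB addrC subrK.
rewrite normsqB// -/M; set z := fun x => u x - v x in h1 h2 uvL *.
have := cauchy_schwarz mD mw w0 uL uvL; rewrite -/M -/z.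
have z0 := normsq_ge0 mu w0 z; set dz := nsq z in h1 h2 z0 *.
rewrite /sqmod; set a := complex.Re _; set b := complex.Im _ => cs.
have b0 := sqr_ge0 b.
have H : `|2 * a| < e / 2.
  rewrite -(@ltr_pXn2r _ 2)// ?nnegrE ?normr_ge0//; last by lra.
  by rewrite real_normK ?num_real//; nra.
move: H; rewrite !ltr_norml => /andP[g1 g2]; apply/andP; split; lra.
Qed.

Variables (mu' : {measure set T' -> \bar R}) (D' : set T') (w' : T' -> R).
Hypothesis mD' : measurable D'.
Hypothesis mw' : measurable_fun D' w'.
Hypothesis w'0 : forall x, D' x -> 0 <= w' x.

(** Families with equal Gram matrices span isometric spaces. This yields both the isometry of the
    stochastic integral and that between a sequence and its exponentials. *)
Lemma normsq_sum_eq (I : eqType) (s : seq I) (c : I -> R[i])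
    (u : I -> T -> R[i]) (v : I -> T' -> R[i]) :
  (forall i, i \in s -> L2u (u i)) ->
  (forall i, i \in s -> L2 mu' D' w' (v i)) ->
  (forall i j, i \in s -> j \in s ->
     ip (u i) (u j) = inner mu' D' w' (v i) (v j)) ->
  nsq (fun x => \sum_(i <- s) c i * u i x) =
  normsq mu' D' w' (fun x => \sum_(i <- s) c i * v i x).
Proof.
move=> uL vL uv; have sL := L2_sum mD mw w0 c uL; have sL' := L2_sum mD' mw' w'0 c vL.
have inj (a b : R) : a%:C = b%:C :> R[i] -> a = b by move=> [].
apply: inj; rewrite -!inner_normsq// !inner_suml// !big_seq.
apply: eq_bigr => i si; rewrite !inner_sumr//; [|exact: vL|exact: uL].
by congr (_ * _); rewrite !big_seq; apply: eq_bigr => j sj; rewrite uv.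
Qed.

End InnerProducts.

(** * Orthogonal stochastic measures and their sum *)

Section OrthogonalMeasures.
Context {R : realType} {d} {T : measurableType d} (P : probability T R).
Local Notation mR := (measurableTypeR R).
Local Notation leb := (@lebesgue_measure R).
Local Notation D := (@circle R : set mR).
Local Notation L2P := (L2 P setT (fun=> 1)).
Local Notation normsqP := (normsq P setT (fun=> 1)).
Local Notation innerP := (inner P setT (fun=> 1)).
Implicit Types (Z : set R -> T -> R[i]) (w : mR -> R).

Let mT : measurable (setT : set T). Proof. exact: measurableT. Qed.
Let m1 : measurable_fun (setT : set T) (fun=> 1 : R). Proof. exact: measurable_cst. Qed.
Let one0 (t : T) : setT t -> 0 <= (fun=> 1 : R) t. Proof. by []. Qed.
Let mD := @measurable_circle R.

Lemma inner_indic w (A B : set mR) : leb.-integrable D (EFin \o w) ->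
  measurable A -> measurable B -> A `<=` circle -> B `<=` circle ->
  inner leb D (density w) (fun x => (\1_A x)%:C) (fun x => (\1_B x)%:C) =
  ((2 * pi)^-1 * \int[leb]_(x in A `&` B) w x)%:C.
Proof.
move=> iw mA mB AD BD.
have mAB : measurable (A `&` B) by exact: measurableI.
have ABD : A `&` B `<=` D by move=> x [/AD].
have iAB : leb.-integrable (A `&` B) (EFin \o w) by exact: integrableS iw.
rewrite /inner (@eq_cintegral _ _ _ _ _ _
  (fun x => (\1_(A `&` B) x * density w x)%:C)); last first.
  by move=> x _; rewrite conjc_real indicI -2!rmorphM.
rewrite cintegral_ofreal//; congr (_%:C).
rewrite -RintegralZl// Rintegral_mkcond [in RHS]Rintegral_mkcond.
apply: eq_Rintegral => x _; rewrite !patchE indicE.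
have [xAB|xAB] := boolP (x \in A `&` B); last by rewrite mul0r; case: ifP.
have -> : x \in D by rewrite inE; apply: ABD; rewrite inE in xAB.
by rewrite mul1r.
Qed.

Lemma orthogonal_measure_isometry w Z s :
  (forall x, D x -> 0 <= w x) -> leb.-integrable D (EFin \o w) ->
  orthogonal_stochastic_measure P w Z -> simple_wf s ->
  normsqP (simple_integral Z s) = normsq leb D (density w) (simple_fun s).
Proof.
move=> w0 iw [ZL _ Zorth] ws.
apply: normsq_sum_eq => //.
- exact: measurable_density (measurable_weight iw).
- exact: density_ge0.
- by move=> p /(simple_wf_mem ws)[mA AD]; apply/second_orderE; exact: ZL.
- by move=> p /(simple_wf_mem ws)[mA AD]; exact: L2_indic.
- move=> p q /(simple_wf_mem ws)[mA AD] /(simple_wf_mem ws)[mB BD].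
  by rewrite inner_indic// -cexpectation_inner Zorth.
Qed.

Lemma orthogonal_measure_L2 w Z : orthogonal_stochastic_measure P w Z ->
  forall A : set mR, measurable A -> A `<=` circle -> L2P (Z A).
Proof. by move=> [ZL _ _] A mA AD; apply/second_orderE; exact: ZL. Qed.

Lemma orthogonal_measure_bounded w Z :
  (forall x, D x -> 0 <= w x) -> leb.-integrable D (EFin \o w) ->
  orthogonal_stochastic_measure P w Z -> forall s, simple_wf s ->
  normsqP (simple_integral Z s) <= 1 * normsq leb D (density w) (simple_fun s).
Proof.
by move=> w0 iw oZ s ws; rewrite mul1r (orthogonal_measure_isometry w0 iw oZ ws).
Qed.

Section Sum.
Variables (f g : mR -> R) (Zxi Zeta : set R -> T -> R[i]).
Hypothesis f0 : forall x, D x -> 0 <= f x.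
Hypothesis g0 : forall x, D x -> 0 <= g x.
Hypothesis iF : leb.-integrable D (EFin \o f).
Hypothesis iG : leb.-integrable D (EFin \o g).
Hypothesis oZxi : orthogonal_stochastic_measure P f Zxi.
Hypothesis oZeta : orthogonal_stochastic_measure P g Zeta.

Let w x := f x + g x.
Let Z A t := Zxi A t + Zeta A t.

Lemma sum_density_ge0 x : D x -> 0 <= w x.
Proof. by move=> Dx; rewrite addr_ge0 ?f0 ?g0. Qed.

Lemma integrable_sum_density : leb.-integrable D (EFin \o w).
Proof. have := integrableD mD iF iG; exact: eq_integrable. Qed.

Let mf := measurable_weight iF.
Let mg := measurable_weight iG.

Lemma L2_sum_density u : L2 leb D (density w) u <->
  L2 leb D (density f) u /\ L2 leb D (density g) u.
Proof.
split.
- move=> [mu fu]; rewrite enormsq_densityD// in fu; split; split => //;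
    apply: le_lt_trans fu.
  + by rewrite leeDl// (enormsq_ge0 _ (density_ge0 g0)).
  + by rewrite leeDr// (enormsq_ge0 _ (density_ge0 f0)).
- move=> [uf ug]; split; first exact: uf.1.
  rewrite enormsq_densityD//; last exact: uf.1.
  by rewrite (enormsqE (density_ge0 f0) uf) (enormsqE (density_ge0 g0) ug) -EFinD ltry.
Qed.

Lemma normsq_sum_density u : L2 leb D (density w) u ->
  normsq leb D (density w) u = normsq leb D (density f) u + normsq leb D (density g) u.
Proof.
move=> uw; have [uf ug] := (L2_sum_density u).1 uw.
rewrite {1}/normsq enormsq_densityD//; last exact: uf.1.
by rewrite (enormsqE (density_ge0 f0) uf) (enormsqE (density_ge0 g0) ug).
Qed.

Lemma sum_measure_L2 (A : set mR) : measurable A -> A `<=` circle -> L2P (Z A).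
Proof.
move=> mA AD; apply: (L2D mT m1 one0).
- exact: (orthogonal_measure_L2 oZxi).
- exact: (orthogonal_measure_L2 oZeta).
Qed.

Lemma simple_integral_sum s : simple_integral Z s =
  fun t => simple_integral Zxi s t + simple_integral Zeta s t.
Proof.
apply/funext => t; rewrite /simple_integral -big_split/=.
by apply: eq_bigr => p _; rewrite mulrDr.
Qed.

(** Nothing is known about the correlation of [Zxi] with [Zeta], so the two isometries are combined
    by the factor 2 inequality instead of by Pythagoras. *)
Lemma sum_measure_bounded s : simple_wf s ->
  normsqP (simple_integral Z s) <= 2 * normsq leb D (density w) (simple_fun s).
Proof.
move=> ws; rewrite simple_integral_sum.
apply: le_trans (normsqD_le mT m1 one0 _ _) _.
- exact: (L2_simple_integral (orthogonal_measure_L2 oZxi)).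
- exact: (L2_simple_integral (orthogonal_measure_L2 oZeta)).
rewrite (orthogonal_measure_isometry f0 iF oZxi ws).
rewrite (orthogonal_measure_isometry g0 iG oZeta ws).
rewrite normsq_sum_density ?mulrDr//.
exact: (L2_simple sum_density_ge0 integrable_sum_density).
Qed.

(** The two given integrals may come with different simple functions. One s close to h in L_2(f + g)
    is close in both L_2(f) and L_2(g), and [ms_integral_bound] applied to h - s then controls both
    integrals. *)
Lemma ms_integral_sum_measure h Yxi Yeta : L2 leb D (density w) h ->
  ms_integral P f Zxi h Yxi -> ms_integral P g Zeta h Yeta ->
  ms_integral P w Z h (fun t => Yxi t + Yeta t).
Proof.
move=> hL Hxi Heta; have [_ Yxi2 _] := Hxi; have [_ Yeta2 _] := Heta.
split => //; first exact: (L2D mT m1 one0).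
(* The final error is at most 2 * 4 = 8 times the squared distance from h to s, hence below e /
   4. *)
move=> e e0; have e16 : 0 < e / 32 by rewrite divr_gt0.
have [s [ws hs]] := simple_dense sum_density_ge0 integrable_sum_density hL e16.
exists s; split => //; first by apply: lt_trans hs _; lra.
have oxi := orthogonal_measure_L2 oZxi; have oeta := orthogonal_measure_L2 oZeta.
have Ixi := ms_integralB f0 iF oxi Hxi (ms_integral_simple f0 iF oxi ws).
have Ieta := ms_integralB g0 iG oeta Heta (ms_integral_simple g0 iG oeta ws).
have bxi := ms_integral_bound f0 iF ler01 oxi
  (orthogonal_measure_bounded f0 iF oZxi) Ixi.
have beta := ms_integral_bound g0 iG ler01 oeta
  (orthogonal_measure_bounded g0 iG oZeta) Ieta.
rewrite simple_integral_sum.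
under [X in normsqP X]eq_fun do rewrite opprD addrACA.
have [_ Lxi _] := Ixi; have [_ Leta _] := Ieta.
apply: le_lt_trans (normsqD_le mT m1 one0 Lxi Leta) _.
have wL := L2_simple sum_density_ge0 integrable_sum_density ws.
have mw := measurable_density (measurable_weight integrable_sum_density).
have hsL := L2B mD mw (density_ge0 sum_density_ge0) hL wL.
rewrite normsq_sum_density// in hs.
have := normsq_ge0 leb (density_ge0 f0) (fun x => h x - simple_fun s x).
have := normsq_ge0 leb (density_ge0 g0) (fun x => h x - simple_fun s x).
lra.
Qed.

End Sum.
End OrthogonalMeasures.

(** * Covariances of the sequences as inner products of exponentials *)

Section SpectralRepresentation.
Context {R : realType} {d} {T : measurableType d} (P : probability T R).
Local Notation mR := (measurableTypeR R).
Local Notation leb := (@lebesgue_measure R).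
Local Notation D := (@circle R : set mR).
Local Notation L2P := (L2 P setT (fun=> 1)).
Local Notation normsqP := (normsq P setT (fun=> 1)).
Local Notation innerP := (inner P setT (fun=> 1)).

Let mT : measurable (setT : set T). Proof. exact: measurableT. Qed.
Let m1 : measurable_fun (setT : set T) (fun=> 1 : R). Proof. exact: measurable_cst. Qed.
Let one0 (t : T) : setT t -> 0 <= (fun=> 1 : R) t. Proof. by []. Qed.
Let mD := @measurable_circle R.

Lemma cintegrable_chiM (r : mR -> R) j : leb.-integrable D (EFin \o r) ->
  cintegrable leb D (fun x => chi j x * (r x)%:C).
Proof.
move=> ir; have /integrableP[/measurable_EFinP mr _] := ir.
have [m1' m2'] : @cmeasurable _ mR R D (fun x => chi j x * (r x)%:C).
  by apply: cmeasurableM; [exact: cmeasurable_chi | exact: cmeasurableC].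
split; apply: (le_integrable mD _ _ ir).
- exact/measurable_EFinP.
- move=> x _; rewrite /= lee_fin mulr0 subr0 normrM ler_piMl//.
  by rewrite ler_norml cos_le1 cos_geN1.
- exact/measurable_EFinP.
- move=> x _; rewrite /= lee_fin mulr0 add0r normrM ler_piMl//.
  by rewrite ler_norml sin_le1 sin_geN1.
Qed.

Lemma fourierE (r : mR -> R) k : leb.-integrable D (EFin \o r) ->
  fourier k r = cintegral leb D (fun x => chi k x * (density r x)%:C).
Proof.
move=> ir; rewrite /fourier -cintegralZ//; last exact: cintegrable_chiM.
by apply: eq_cintegral => x _; rewrite /density rmorphM mulrCA.
Qed.

Lemma inner_chi (w : mR -> R) j k : leb.-integrable D (EFin \o w) ->
  inner leb D (density w) (chi j) (chi k) = fourier (j - k) w.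
Proof.
by move=> iw; rewrite fourierE//; apply: eq_cintegral => x _; rewrite chiMJ.
Qed.

Lemma inner_process (X : int -> T -> R[i]) (f : mR -> R) j k :
  spectral_density P X f -> innerP (X j) (X k) = fourier (j - k) f.
Proof.
by move=> [_ _ H]; rewrite -cexpectation_inner -(H k (j - k)) addrC subrK.
Qed.

(** Coefficients are paired with indices in a list so that two combinations can be concatenated even
    when they share indices. *)
Lemma normsq_process (X : int -> T -> R[i]) (f : mR -> R) (L : seq (R[i] * int)) :
  (forall j, L2P (X j)) -> spectral_density P X f ->
  normsqP (fun t => \sum_(p <- L) p.1 * X p.2 t) =
  normsq leb D (density f) (fun x => \sum_(p <- L) p.1 * chi p.2 x).
Proof.
move=> XL sX; have [f0 iF _] := sX.
apply: normsq_sum_eq => //.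
- exact: measurable_density (measurable_weight iF).
- exact: density_ge0.
- move=> p _; exact: (L2_chi (density_ge0 f0) (integrable_density iF)).
- by move=> p q _ _; rewrite (inner_process _ _ sX) inner_chi.
Qed.

(** Pythagoras: the zero means turn vanishing covariances into orthogonality. *)
Lemma normsq_uncorrelated (X Y : int -> T -> R[i]) (L L' : seq (R[i] * int)) :
  (forall j, L2P (X j)) -> (forall j, L2P (Y j)) ->
  zero_mean P X -> zero_mean P Y -> uncorrelated P X Y ->
  normsqP (fun t => \sum_(p <- L) p.1 * X p.2 t - \sum_(p <- L') p.1 * Y p.2 t) =
  normsqP (fun t => \sum_(p <- L) p.1 * X p.2 t) +
  normsqP (fun t => \sum_(p <- L') p.1 * Y p.2 t).
Proof.
move=> XL YL X0 Y0 XY.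
have orth j k : innerP (X j) (Y k) = 0.
  have := XY j k; rewrite /ccovariance X0 Y0 -cexpectation_inner.
  by move=> <-; congr cexpectation; apply/funext => t; rewrite !subr0.
have SX : L2P (fun t => \sum_(p <- L) p.1 * X p.2 t).
  by apply: (L2_sum mT m1 one0 _ (u := fun p => X p.2)).
have SY : L2P (fun t => \sum_(p <- L') p.1 * Y p.2 t).
  by apply: (L2_sum mT m1 one0 _ (u := fun p => Y p.2)).
rewrite normsqB// (@inner_suml _ _ _ P setT (fun=> 1) mT m1 one0 _ L (fun p => p.1)
  (fun p => X p.2))//.
rewrite big1 ?mulr0 ?subr0// => p _.
rewrite (@inner_sumr _ _ _ P setT (fun=> 1) mT m1 one0 _ L' (fun p => p.1)
  (fun p => Y p.2))//.
by rewrite big1 ?mulr0// => q _; rewrite orth mulr0.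
Qed.

End SpectralRepresentation.

(** * Integrals of the exponentials over the circle *)

Lemma integral_is_derive (R : realType) (F F' : R -> R) (a b : R) : a < b ->
  (forall x : R, is_derive x (1 : R) F (F' x)) -> continuous F' ->
  \int[lebesgue_measure]_(x in `[a, b]) F' x = F b - F a.
Proof.
move=> ab dF cF'.
have cF : continuous F.
  by move=> x; apply: differentiable_continuous; apply/derivable1_diffP.
rewrite /Rintegral (continuous_FTC2 ab (F := F))//.
- exact: continuous_subspaceT.
- split; first by move=> x _.
  + by apply: cvg_at_right_filter; exact: cF.
  + by apply: cvg_at_left_filter; exact: cF.
- by move=> x _; rewrite derive1E derive_val.
Qed.

Section ExponentialIntegrals.
Context {R : realType}.
Local Notation mR := (measurableTypeR R).
Local Notation leb := (@lebesgue_measure R).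
Local Notation D := (@circle R : set mR).

(** That is, sin(j pi) = 0, read off from (e^{i pi})^n = (-1)^n. *)
Lemma Im_chi_pi (j : int) : complex.Im (chi j pi : R[i]) = 0.
Proof.
have natc (n : nat) : complex.Im (chi n%:Z pi : R[i]) = 0.
  rewrite chi_nat /chi /expi mul1r cospi sinpi.
  by rewrite (_ : (-1) +i* 0 = ((-1) ^+ 1)%:C)// -rmorphXn.
have [|n|n] := intP j; [exact: (natc 0%N)|exact: natc|].
by rewrite chiN; have := natc n.+1; case: (chi _ pi) => a b /= ->; rewrite oppr0.
Qed.

Lemma lebesgue_circle : (leb : {measure set mR -> \bar R}) D = (2 * pi)%:E.
Proof.
have := @lebesgue_measure_itv R `[- pi, pi]; rewrite /= lte_fin.
have -> : - pi < pi :> R by have := pi_gt0 R; lra.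
by rewrite -EFinD opprK mulr_natl mulr2n.
Qed.

Lemma integrable_circle_cst (r : R) : leb.-integrable D (EFin \o (fun=> r)).
Proof.
apply/integrableP; split; first exact: measurable_cst.
rewrite /= integral_cst; last exact: measurable_circle.
by rewrite [X in (_ * X < _)%E]lebesgue_circle -EFinM ltry.
Qed.

Lemma fourier1 (j : int) : fourier j (fun=> 1 : R) = (j == 0)%:R.
Proof.
have pipi : - pi < pi :> R by have := pi_gt0 R; lra.
rewrite /fourier.
have -> : cintegral leb D (fun x => chi j x * 1%:C) = ((j == 0)%:R * (2 * pi))%:C.
  have [->|j0] := eqVneq j 0.
    rewrite (@eq_cintegral _ _ _ _ _ _ (fun=> 1%:C)); last first.
      by move=> x _; rewrite chi0 mul1r.
    rewrite (cintegral_ofreal _ measurable_circle) Rintegral_cst//.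
      by rewrite [X in fine X]lebesgue_circle /= !mul1r.
    exact: measurable_circle.
  have jR : j%:~R != 0 :> R by rewrite intr_eq0.
  rewrite mul0r /cintegral; congr (_ +i* _).
  - have cos0 : \int[leb]_(x in `[- pi, pi]) cos (j%:~R * x) = 0 :> R.
      have dF (x : R) : is_derive x (1 : R) (fun x : R => j%:~R^-1 * sin (j%:~R * x))
          (cos (j%:~R * x)).
        by apply: is_derive_eq; rewrite !scaler1 /GRing.scale/=; field.
      have cF : continuous (fun x : R => cos (j%:~R * x)).
        move=> x; apply: continuous_comp; last exact: continuous_cos.
        exact: mulrl_continuous.
      rewrite (integral_is_derive pipi dF cF).
      have := Im_chi_pi j; rewrite /chi /expi /= mulrN sinN => ->.
      by rewrite oppr0 mulr0 subrr.
    rewrite -[RHS]cos0; apply: eq_Rintegral => x _ /=.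
    by rewrite mulr0 subr0 mulr1.
  - have sin0 : \int[leb]_(x in `[- pi, pi]) sin (j%:~R * x) = 0 :> R.
      have dF (x : R) : is_derive x (1 : R) (fun x : R => - j%:~R^-1 * cos (j%:~R * x))
          (sin (j%:~R * x)).
        by apply: is_derive_eq; rewrite !scaler1 /GRing.scale/=; field.
      have cF : continuous (fun x : R => sin (j%:~R * x)).
        move=> x; apply: continuous_comp; last exact: continuous_sin.
        exact: mulrl_continuous.
      by rewrite (integral_is_derive pipi dF cF) mulrN cosN subrr.
    rewrite -[RHS]sin0; apply: eq_Rintegral => x _ /=.
    by rewrite mulr0 add0r mulr1.
rewrite -rmorphM mulrCA mulVf ?mulr1; last by rewrite mulf_neq0// gt_eqF ?pi_gt0.
by case: (j == 0).
Qed.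

End ExponentialIntegrals.

(** * The biorthogonal system e^{ikx} / w and the space spanned by the observed exponentials *)

Section WeightedExponentials.
Context {R : realType}.
Local Notation mR := (measurableTypeR R).
Local Notation leb := (@lebesgue_measure R).
Local Notation D := (@circle R : set mR).
Variable w : mR -> R.
Hypothesis w0 : forall x, D x -> 0 <= w x.
Hypothesis iw : leb.-integrable D (EFin \o w).
Hypothesis minimal : (\int[leb]_(x in D) ((w x)%:E)^-1 < +oo)%E.

Local Notation L2w := (L2 leb D (density w)).
Local Notation normsqw := (normsq leb D (density w)).
Local Notation innerw := (inner leb D (density w)).

Let mD := @measurable_circle R.
Let mw := measurable_weight iw.
Let dw0 := density_ge0 w0.
Let mdw := measurable_density mw.
Let idw := integrable_density iw.

Lemma measurable_inv_weight : measurable_fun D (fun x => (w x)^-1).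
Proof.
apply: (eq_measurable_fun (fun x => (w x) `^ (-1))).
  by move=> x; rewrite inE => Dx; rewrite powR_inv1// w0.
have H : measurable_fun setT (fun y : R => y `^ (-1)) by exact: measurable_powR.
exact: (measurableT_comp H mw).
Qed.
Let mV := measurable_inv_weight.

(** At zeros of w the real inverse is 0 and the extended one is +oo; the correction term in the
    proof accounts for this difference. *)
Let mVe : measurable_fun D (fun x => ((w x)%:E)^-1%E).
Proof.
pose A := D `&` w @^-1` [set 0].
have mA : measurable A by apply: mw.
apply: (eq_measurable_fun (fun x => ((w x)^-1)%:E + (\1_A x)%:E * +oo)%E).
  move=> x xD; rewrite inver indicE in_setI xD /=.
  have [wx|wx] := eqVneq (w x) 0.
    have -> : x \in w @^-1` [set 0] by rewrite inE.
    by rewrite wx invr0 add0e mul1e.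
  have -> : x \in w @^-1` [set 0] = false.
    by apply/negbTE; rewrite notin_setE => /eqP; apply/negP.
  by rewrite mul0e adde0.
apply: emeasurable_funD; first exact/measurable_EFinP.
apply: emeasurable_funM; last exact: measurable_cst.
by apply/measurable_EFinP; exact: measurable_indic.
Qed.

Let inv_ge0 x : D x -> (0 <= ((w x)%:E)^-1)%E.
Proof. by move=> Dx; rewrite inve_ge0 lee_fin w0. Qed.

Let iVe : leb.-integrable D (fun x => ((w x)%:E)^-1%E).
Proof.
apply/integrableP; split; first exact: mVe.
rewrite (eq_integral (fun x => ((w x)%:E)^-1%E))// => x.
by rewrite inE => Dx; rewrite gee0_abs// inv_ge0.
Qed.

(** An integrable function is finite almost everywhere, and the extended inverse of w is +oo exactly
    at the zeros of w. *)
Lemma weight_gt0_ae : {ae leb, forall x, D x -> 0 < w x}.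
Proof.
have H := integrable_ae mD iVe; apply: (filterS _ H) => x wx Dx.
rewrite lt_neqAle w0// andbT eq_sym; apply/negP => /eqP wx0.
by have := wx Dx; rewrite wx0 inve0.
Qed.

Lemma integrable_inv_weight : leb.-integrable D (EFin \o (fun x => (w x)^-1)).
Proof.
apply: (le_integrable mD _ _ iVe); first exact/measurable_EFinP.
move=> x Dx; rewrite /= inver; case: ifPn => [/eqP ->|wx].
  by rewrite /= leey.
by [].
Qed.

Definition dual_chi (k : int) (x : mR) : R[i] := chi k x * ((w x)^-1)%:C.

(** Valid at zeros of w as well, because the inverse of 0 is 0; the Gram matrix of the dual system
    is thus computed pointwise. *)
Let V3 x : (w x)^-1 * ((w x)^-1 * w x) = (w x)^-1.
Proof.
have [->|wx] := eqVneq (w x) 0; first by rewrite invr0 mul0r.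
by rewrite mulVf ?mulr1.
Qed.

Lemma L2_dual_chi k : L2w (dual_chi k).
Proof.
split; first by apply: cmeasurableM; [exact: cmeasurable_chi | exact: cmeasurableC].
have /integrableP[_] := integrable_density integrable_inv_weight.
apply: le_lt_trans; rewrite /enormsq le_eqVlt; apply/orP; left; apply/eqP.
apply: eq_integral => x; rewrite inE => Dx.
rewrite /dual_chi sqmodM sqmod_chi mul1r sqmodC /= ger0_norm; last first.
  by rewrite density_ge0// => y Dy; rewrite invr_ge0 w0.
by rewrite /density expr2 mulrCA -mulrA V3.
Qed.

(** The second hypothesis says that r vanishes wherever w does, so the weight cancels at every
    point. *)
Lemma inner_dual_chi (r : mR -> R) j k : leb.-integrable D (EFin \o r) ->
  (forall x, D x -> r x * (w x)^-1 * w x = r x) ->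
  innerw (fun x => chi k x * (r x)%:C) (dual_chi j) = fourier (k - j) r.
Proof.
move=> ir rw; rewrite fourierE//; apply: eq_cintegral => x; rewrite inE => Dx.
rewrite /dual_chi conjcM conjc_real mulrACA chiMJ -mulrA -!rmorphM.
by congr (_ * _%:C); rewrite /density mulrCA rw.
Qed.

Lemma dual_chi_gram j k :
  innerw (dual_chi k) (dual_chi j) = fourier (k - j) (fun x => (w x)^-1).
Proof.
apply: inner_dual_chi; first exact: integrable_inv_weight.
by move=> x _; rewrite -mulrA V3.
Qed.

(** Here the cancellation is w^-1 w = 1, which fails at zeros of w; the integrands agree only almost
    everywhere, hence the use of [weight_gt0_ae]. *)
Lemma chi_dual_chi j k : innerw (chi k) (dual_chi j) = (k == j)%:R.
Proof.
have i1 : leb.-integrable D (EFin \o (fun=> 1 : R)).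
  exact: integrable_circle_cst.
rewrite -subr_eq0 -fourier1 fourierE//.
have [m1 m2] : @cmeasurable _ mR R D
    (fun x => chi k x * conjc (dual_chi j x) * (density w x)%:C).
  apply: cmeasurableM; last exact: cmeasurableC.
  apply: cmeasurableM; first exact: cmeasurable_chi.
  by apply: cmeasurableJ; exact: (L2_dual_chi j).1.
have [n1 n2] : @cmeasurable _ mR R D
    (fun x => chi (k - j) x * (density (fun=> 1) x)%:C).
  apply: cmeasurableM; first exact: cmeasurable_chi.
  by apply: cmeasurableC; exact: measurable_cst.
have E : {ae leb, forall x, D x ->
    chi k x * conjc (dual_chi j x) * (density w x)%:C =
    chi (k - j) x * (density (fun=> 1) x)%:C}.
  have H := weight_gt0_ae; apply: (filterS _ H) => x wx Dx.
  rewrite /dual_chi conjcM conjc_real mulrA chiMJ -mulrA -!rmorphM.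
  by congr (_ * _%:C); rewrite /density mulrCA mulVf// gt_eqF// wx.
rewrite /inner /cintegral /Rintegral; congr (fine _ +i* fine _);
  apply: ae_eq_integral => //; try exact/measurable_EFinP;
  by apply: (filterS _ E) => x Ex Dx; rewrite Ex.
Qed.

(** Pairing with [dual_chi k] annihilates the allowed exponentials and, by Cauchy-Schwarz, is
    continuous on L_2(w). *)
Lemma inL2N_orthogonal (N : nat) h k : inL2N w N h -> (k <= N)%N ->
  innerw h (dual_chi k%:Z) = 0.
Proof.
move=> [/(inL2E _ mw w0) hL H] kN; apply/eqP; rewrite -sqmod_eq0 eq_le sqmod_ge0 andbT.
set M := normsqw (dual_chi k%:Z).
have M0 : 0 <= M := normsq_ge0 leb dw0 _.
apply/ler_addgt0Pl => e e0; rewrite addr0.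
have M1 : 0 < M + 1 by lra.
have [J [c [Jc hp]]] := H _ (divr_gt0 e0 M1).
pose p x := \sum_(j <- J) c j * chi j x : R[i].
have pL : L2w p by apply: (L2_sum mD mdw dw0) => j _; exact: (L2_chi dw0 idw).
have hpL := L2B mD mdw dw0 hL pL.
rewrite L2normsqE// in hp; last exact: hpL.1.
rewrite (enormsqE dw0 hpL) lte_fin ltr_pdivlMr// in hp.
have p0 : innerw p (dual_chi k%:Z) = 0.
  rewrite (inner_suml mD mdw dw0)//; last 2 first.
  - by move=> j _; exact: (L2_chi dw0 idw).
  - exact: L2_dual_chi.
  rewrite big_seq big1// => j jJ; rewrite chi_dual_chi.
  have [jk|_] := eqVneq j k%:Z; last by rewrite mulr0.
  by have := Jc _ jJ; rewrite jk lez_nat kN.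
have -> : innerw h (dual_chi k%:Z) = innerw (fun x => h x - p x) (dual_chi k%:Z).
  by rewrite (innerBl mD mdw dw0)// ?p0 ?subr0//; exact: L2_dual_chi.
apply: le_trans (cauchy_schwarz mD mdw dw0 hpL (L2_dual_chi _)) _.
rewrite -/M; apply: le_trans (ltW hp).
by rewrite ler_wpM2l ?(normsq_ge0 _ dw0)//; lra.
Qed.

(** The exponential constant is harmless: the sum is later taken over at most N + 1 frequencies. *)
Lemma normsq_sum_le (s : seq int) (c : int -> R[i]) (u : int -> mR -> R[i]) :
  (forall j, L2w (u j)) ->
  normsqw (fun x => \sum_(j <- s) c j * u j x) <=
  2 ^+ size s * \sum_(j <- s) sqmod (c j) * normsqw (u j).
Proof.
move=> uL; elim: s => [|j s IH].
  under eq_fun do rewrite big_nil.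
  rewrite big_nil mulr0 /normsq /enormsq; under eq_integral do rewrite sqmod0 mul0r.
  by rewrite integral0.
under eq_fun do rewrite big_cons.
apply: le_trans (normsqD_le mD mdw dw0 (L2Z mD mdw dw0 _ (uL j))
  (L2_sum mD mdw dw0 c (fun i _ => uL i))) _.
rewrite normsqZ//= big_cons exprS.
have q1 : 1 <= (2 : R) ^+ size s by rewrite exprn_ege1// ler1n.
have A0 : 0 <= sqmod (c j) * normsqw (u j).
  by rewrite mulr_ge0 ?sqmod_ge0 ?(normsq_ge0 _ dw0).
by rewrite -mulrDr -(mulrA 2) ler_wpM2l// mulrDr lerD// ler_peMl.
Qed.

(** Take a trigonometric polynomial p near h and delete its forbidden part q. Orthogonality of h
    makes the coefficients of q small along with h - p, so p - q still approximates h. *)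
Lemma orthogonal_inL2N (N : nat) h : L2w h ->
  (forall k, (k <= N)%N -> innerw h (dual_chi k%:Z) = 0) -> inL2N w N h.
Proof.
move=> hL h0; split; first exact/(inL2E _ mw w0).
move=> e e0.
pose M := \sum_(k < N.+1) normsqw (dual_chi k%:Z) * normsqw (chi 0).
have M0 : 0 <= M by apply: sumr_ge0 => k _; rewrite mulr_ge0 ?(normsq_ge0 _ dw0).
pose C := 2 ^+ N.+1 * M.
have C0 : 0 <= C by rewrite mulr_ge0 ?exprn_ge0.
(* The squared norm of (h - p) + q is at most 2 + 2 C times that of h - p, once q is bounded by
   [C]. *)
have C1 : 0 < 2 + 2 * C + 1 by lra.
have [_ /(_ _ (divr_gt0 e0 C1))[p [pt pL hp]]] := trigpoly_dense dw0 idw hL.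
have [J [c [uJ pE]]] := trigpoly_sum pt.
pose bad (j : int) := 0 <= j <= N%:Z.
exists [seq j <- J | ~~ bad j], c; split.
  by move=> j; rewrite mem_filter => /andP[].
have hpL := L2B mD mdw dw0 hL pL.
pose q x := \sum_(j <- [seq j <- J | bad j]) c j * chi j x : R[i].
have chiL j : L2w (chi j) := L2_chi dw0 idw j.
have qL : L2w q by apply: (L2_sum mD mdw dw0) => j _.
have split_h x : h x - \sum_(j <- [seq j <- J | ~~ bad j]) c j * chi j x =
    (h x - p x) + q x.
  have E : p x = q x + \sum_(j <- [seq j <- J | ~~ bad j]) c j * chi j x.
    by rewrite pE /= (bigID bad)/= /q !big_filter.
  by rewrite E; ring.
have hqL := L2D mD mdw dw0 hpL qL.
under eq_fun do rewrite split_h.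
rewrite L2normsqE//; last exact: hqL.1.
rewrite (enormsqE dw0 hqL) lte_fin.
apply: le_lt_trans (normsqD_le mD mdw dw0 hpL qL) _.
suff : normsqw q <= C * normsqw (fun x => h x - p x).
  move: hp; rewrite ltr_pdivlMr// => hp; have := normsq_ge0 leb dw0 (fun x => h x - p x).
  by lra.
(* Since h is orthogonal to [dual_chi k], pairing h - p with it gives minus the coefficient of p at
   k; the distinct frequencies of [J] ensure that only one term survives. *)
have cE k : (k <= N)%N -> k%:Z \in J ->
    sqmod (c k%:Z) <= normsqw (fun x => h x - p x) * normsqw (dual_chi k%:Z).
  move=> kN kJ.
  have : innerw (fun x => h x - p x) (dual_chi k%:Z) = - c k%:Z.
    rewrite (innerBl mD mdw dw0)//; last exact: L2_dual_chi.
    rewrite h0// sub0r pE (inner_suml mD mdw dw0)//; last exact: L2_dual_chi.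
    rewrite (bigD1_seq k%:Z)//= chi_dual_chi eqxx mulr1 big1 ?addr0// => j jk.
    by rewrite chi_dual_chi (negbTE jk) mulr0.
  move=> E; rewrite -(sqmodN (c _)) -E.
  exact: (cauchy_schwarz mD mdw dw0 hpL (L2_dual_chi _)).
have chiE j : normsqw (chi j) = normsqw (chi 0).
  by rewrite /normsq /enormsq; congr fine; apply: eq_integral => x _; rewrite !sqmod_chi.
set s := [seq j <- J | bad j].
have us : uniq s by rewrite filter_uniq.
(* This inclusion bounds both the number of forbidden frequencies and the sum over them. *)
have sub : {subset s <= [seq k%:Z | k <- iota 0 N.+1]}.
  move=> j; rewrite mem_filter => /andP[/andP[j0 jN] _].
  apply/mapP; exists (absz j); last by rewrite gez0_abs.
  by rewrite mem_iota leq0n add0n ltnS -lez_nat gez0_abs.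
apply: le_trans (normsq_sum_le s c chiL) _.
rewrite /C -mulrA; apply: ler_pM.
- by rewrite exprn_ge0.
- by apply: sumr_ge0 => j _; rewrite mulr_ge0 ?sqmod_ge0 ?(normsq_ge0 _ dw0).
- rewrite ler_eXn2l// ?ltr1n//.
  by have := uniq_leq_size us sub; rewrite size_map size_iota.
apply: (@le_trans _ _ (\sum_(j <- s) normsqw (dual_chi j) * normsqw (chi 0) *
    normsqw (fun x => h x - p x))).
  rewrite !big_seq; apply: ler_sum => j js; rewrite chiE mulrAC.
  rewrite ler_wpM2r ?(normsq_ge0 _ dw0)// mulrC.
  have /mapP[k] := sub _ js; rewrite mem_iota add0n ltnS => kN jk.
  by move: js; rewrite mem_filter jk => /andP[_ kJ]; exact: cE.
rewrite -mulr_suml ler_wpM2r ?(normsq_ge0 _ dw0)// /M.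
rewrite -(big_mkord xpredT (fun k => normsqw (dual_chi k%:Z) * normsqw (chi 0))).
rewrite -(big_map (fun k : nat => k%:Z) xpredT
  (fun j => normsqw (dual_chi j) * normsqw (chi 0))) /index_iota subn0.
have us' : uniq [seq k%:Z | k <- iota 0 N.+1].
  by rewrite map_inj_uniq ?iota_uniq// => i j [].
set K := [seq _ | _ <- _] in us' sub *.
have E : \sum_(j <- s) normsqw (dual_chi j) * normsqw (chi 0) =
    \sum_(j <- K | j \in s) normsqw (dual_chi j) * normsqw (chi 0).
  rewrite -[RHS]big_filter; apply: perm_big; apply: uniq_perm => //.
    exact: filter_uniq.
  move=> j; rewrite [in RHS]mem_filter; have [js|//] := boolP (j \in s).
  by rewrite sub.
rewrite E [leRHS](bigID (mem s))/=.
by rewrite lerDl sumr_ge0// => j _; rewrite mulr_ge0 ?(normsq_ge0 _ dw0).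
Qed.

End WeightedExponentials.

(** * The error functional as a mean square error *)

Section Interpolation.
Context {R : realType} {d} {T : measurableType d} (P : probability T R).
Local Notation mR := (measurableTypeR R).
Local Notation leb := (@lebesgue_measure R).
Local Notation D := (@circle R : set mR).
Variables (f g : mR -> R) (N : nat) (a : 'cV[R[i]]_N.+1).

Hypothesis f0 : forall x, D x -> 0 <= f x.
Hypothesis g0 : forall x, D x -> 0 <= g x.
Hypothesis iF : leb.-integrable D (EFin \o f).
Hypothesis iG : leb.-integrable D (EFin \o g).

Let w (x : mR) := f x + g x.
Local Notation L2w := (L2 leb D (density w)).
Local Notation L2P := (L2 P setT (fun=> 1)).
Local Notation normsqf := (normsq leb D (density f)).
Local Notation normsqg := (normsq leb D (density g)).
Local Notation normsqw := (normsq leb D (density w)).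
Local Notation normsqP := (normsq P setT (fun=> 1)).
Local Notation innerw := (inner leb D (density w)).

Let mT : measurable (setT : set T). Proof. exact: measurableT. Qed.
Let m1 : measurable_fun (setT : set T) (fun=> 1 : R). Proof. exact: measurable_cst. Qed.
Let one0 (t : T) : setT t -> 0 <= (fun=> 1 : R) t. Proof. by []. Qed.
Let mD := @measurable_circle R.
Let mf := measurable_weight iF.
Let mg := measurable_weight iG.
Let df0 := density_ge0 f0.
Let dg0 := density_ge0 g0.
Let mdf := measurable_density mf.
Let mdg := measurable_density mg.
Let w0 : forall x, D x -> 0 <= w x := sum_density_ge0 f0 g0.
Let iw : leb.-integrable D (EFin \o w) := integrable_sum_density iF iG.
Let mw := measurable_weight iw.
Let dw0 := density_ge0 w0.
Let mdw := measurable_density mw.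
Let idw := integrable_density iw.

Lemma L2_trigpoly_cV (v : mR -> R) (b : 'cV[R[i]]_N.+1) :
  (forall x, D x -> 0 <= v x) -> leb.-integrable D (EFin \o v) ->
  L2 leb D (density v) (trigpoly b).
Proof.
move=> v0 iv; have dv0 := density_ge0 v0; have idv := integrable_density iv.
apply: (L2_sum mD (measurable_density (measurable_weight iv)) dv0) => j _.
exact: L2_chi.
Qed.

Lemma DeltaE h : L2w h -> Delta f g a h =
  (normsqf (fun x => trigpoly a x - h x) + normsqg h)%:E.
Proof.
move=> /(L2_sum_density f0 g0 iF iG)[hf hg].
have ahL := L2B mD mdf df0 (L2_trigpoly_cV a f0 iF) hf.
rewrite /Delta L2normsqE//; last exact: ahL.1.
rewrite L2normsqE//; last exact: hg.1.
by rewrite (enormsqE df0 ahL) (enormsqE dg0 hg).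
Qed.

Section MeanSquareError.
Variables (xi eta : int -> T -> R[i]) (Zxi Zeta : set R -> T -> R[i]).
Hypothesis xiL : forall j, L2P (xi j).
Hypothesis etaL : forall j, L2P (eta j).
Hypothesis xi_mean : zero_mean P xi.
Hypothesis eta_mean : zero_mean P eta.
Hypothesis xi_eta : uncorrelated P xi eta.
Hypothesis xi_density : spectral_density P xi f.
Hypothesis eta_density : spectral_density P eta g.
Hypothesis oZxi : orthogonal_stochastic_measure P f Zxi.
Hypothesis oZeta : orthogonal_stochastic_measure P g Zeta.
Hypothesis xi_spectral : forall j, stochastic_integral P f Zxi (chi j) (xi j).
Hypothesis eta_spectral : forall j, stochastic_integral P g Zeta (chi j) (eta j).

Let Z A t := Zxi A t + Zeta A t.

Lemma chi_ms_integral j : ms_integral P w Z (chi j) (fun t => xi j t + eta j t).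
Proof.
apply: (ms_integral_sum_measure f0 g0 iF iG oZxi oZeta).
- exact: L2_chi.
- exact/(ms_integralP f0 iF (orthogonal_measure_L2 oZxi)).
- exact/(ms_integralP g0 iG (orthogonal_measure_L2 oZeta)).
Qed.

Lemma L2_functional : L2P (functional xi a).
Proof. by apply: (L2_sum mT m1 one0) => j _; exact: xiL. Qed.

(** Collecting terms, the error is a combination of [xi] alone minus a combination of [eta] alone.
    These are orthogonal, and each has the norm of the matching combination of exponentials. *)
Lemma finite_error (J : seq int) (c : int -> R[i]) :
  normsqP (fun t => functional xi a t - \sum_(j <- J) c j * (xi j t + eta j t)) =
  normsqf (fun x => trigpoly a x - \sum_(j <- J) c j * chi j x) +
  normsqg (fun x => \sum_(j <- J) c j * chi j x).
Proof.
pose L := [seq (a k 0, (k : nat)%:Z) | k <- index_enum 'I_N.+1] ++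
          [seq (- c j, j) | j <- J].
pose L' := [seq (c j, j) | j <- J].
have := normsq_uncorrelated L L' xiL etaL xi_mean eta_mean xi_eta.
rewrite (normsq_process L xiL xi_density) (normsq_process L' etaL eta_density).
have sumL (V : Type) (X : int -> V -> R[i]) y : \sum_(p <- L) p.1 * X p.2 y =
    \sum_(j < N.+1) a j 0 * X j y - \sum_(j <- J) c j * X j y.
  rewrite big_cat/= !big_map; congr (_ + _).
  by rewrite -sumrN; apply: eq_bigr => j _; rewrite mulNr.
have sumL' (V : Type) (X : int -> V -> R[i]) y : \sum_(p <- L') p.1 * X p.2 y =
    \sum_(j <- J) c j * X j y.
  by rewrite big_map.
have e1 : (fun t => \sum_(p <- L) p.1 * xi p.2 t - \sum_(p <- L') p.1 * eta p.2 t) =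
    (fun t => functional xi a t - \sum_(j <- J) c j * (xi j t + eta j t)).
  apply/funext => t; rewrite sumL sumL' -addrA -opprD -big_split/=; congr (_ - _).
  by apply: eq_bigr => j _; rewrite mulrDr.
have e2 : (fun x : mR => \sum_(p <- L) p.1 * chi p.2 x) =
    (fun x => trigpoly a x - \sum_(j <- J) c j * chi j x).
  by apply/funext => x; rewrite sumL.
have e3 : (fun x : mR => \sum_(p <- L') p.1 * chi p.2 x) =
    (fun x => \sum_(j <- J) c j * chi j x :> R[i]).
  by apply/funext => x; rewrite sumL'.
by rewrite e1 e2 e3.
Qed.

Lemma mean_square_error h Y : linear_estimate f g N P Zxi Zeta h Y ->
  Delta f g a h = mean_square P (fun t => functional xi a t - Y t).
Proof.
have scale9 (z r : R) : 0 < r -> z < r / 9 -> 4 * 2 * z < r by lra.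
have near3 (x x' y y' z z' e : R) : `|x - x'| < e / 3 -> `|y - y'| < e / 3 ->
    `|z - z'| < e / 3 -> x' = y' + z' -> `|x - (y + z)| <= e.
  rewrite !ltr_norml ler_norml => /andP[? ?] /andP[? ?] /andP[? ?] xE.
  by apply/andP; split; lra.
move=> [[_ happ] /(ms_integralP w0 iw (sum_measure_L2 oZxi oZeta)) HY].
have [hL YL _] := HY; rewrite DeltaE//.
have [hf hg] := (L2_sum_density f0 g0 iF iG h).1 hL.
have UYL := L2B mT m1 one0 L2_functional YL.
have ahL := L2B mD mdf df0 (L2_trigpoly_cV a f0 iF) hf.
rewrite mean_squareE (enormsqE one0 UYL); congr (_%:E).
apply/eqP; rewrite eq_sym -subr_eq0 -normr_eq0 eq_le normr_ge0 andbT.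
apply/ler_addgt0Pl => e e0; rewrite addr0.
have e3 : 0 < e / 3 by rewrite divr_gt0.
have [r1 r10 H1] := normsq_continuous mT m1 one0 UYL e3.
have [r2 r20 H2] := normsq_continuous mD mdf df0 ahL e3.
have [r3 r30 H3] := normsq_continuous mD mdg dg0 hg e3.
(* 9 exceeds the factor 4 * 2 that [ms_integral_bound] produces with [K = 2]. *)
pose r := Num.min (r1 / 9) (Num.min r2 r3).
have r0 : 0 < r by rewrite !lt_min r20 r30 divr_gt0.
have [J [c [_ hp]]] := happ _ r0.
pose p x := \sum_(j <- J) c j * chi j x : R[i].
pose S t := \sum_(j <- J) c j * (xi j t + eta j t).
have pS : ms_integral P w Z p S.
  apply: (ms_integral_sum w0 iw (sum_measure_L2 oZxi oZeta)) => j.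
  exact: chi_ms_integral.
have hpYS := ms_integralB w0 iw (sum_measure_L2 oZxi oZeta) HY pS.
have [hpL YSL _] := hpYS.
rewrite L2normsqE// in hp; last exact: hpL.1.
rewrite (enormsqE dw0 hpL) lte_fin !lt_min in hp.
have /and3P[hp1 hp2 hp3] := hp.
have bound := ms_integral_bound w0 iw (ler0n _ 2) (sum_measure_L2 oZxi oZeta)
  (sum_measure_bounded f0 g0 iF iG oZxi oZeta) hpYS.
have hpfg := normsq_sum_density f0 g0 iF iG hpL.
have hpf0 := normsq_ge0 leb df0 (fun x => h x - p x).
have hpg0 := normsq_ge0 leb dg0 (fun x => h x - p x).
have [pL SL _] := pS; have [pf pg] := (L2_sum_density f0 g0 iF iG p).1 pL.
have USL := L2B mT m1 one0 L2_functional SL.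
have apL := L2B mD mdf df0 (L2_trigpoly_cV a f0 iF) pf.
have K1 := H1 _ USL; have K2 := H2 _ apL; have K3 := H3 _ pg.
have subE (V : Type) (u v z : V -> R[i]) :
    (fun x => u x - v x - (u x - z x)) = (fun x => z x - v x).
  by apply/funext => x; rewrite opprB addrC addrA subrK.
rewrite subE normsqBC in K1; rewrite subE normsqBC in K2.
have {}K1 : `|normsqP (fun t => functional xi a t - Y t) -
    normsqP (fun t => functional xi a t - S t)| < e / 3.
  by apply: K1; apply: le_lt_trans bound _; exact: scale9.
have {}K2 : `|normsqf (fun x => trigpoly a x - h x) -
    normsqf (fun x => trigpoly a x - p x)| < e / 3.
  by apply: K2; apply: le_lt_trans hp2; rewrite hpfg lerDl.
have {}K3 : `|normsqg h - normsqg p| < e / 3.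
  by apply: K3; apply: le_lt_trans hp3; rewrite hpfg lerDr.
exact: near3 K1 K2 K3 (finite_error J c).
Qed.

Lemma linear_estimate_exists h : inL2N w N h ->
  exists Y, linear_estimate f g N P Zxi Zeta h Y.
Proof.
move=> hN; have [/(inL2E _ mw w0) hL _] := hN.
have [Y HY] := ms_integral_exists w0 iw (ler0n _ 2) (sum_measure_L2 oZxi oZeta)
  (sum_measure_bounded f0 g0 iF iG oZxi oZeta) hL.
by exists Y; split => //; apply/(ms_integralP w0 iw (sum_measure_L2 oZxi oZeta)).
Qed.

End MeanSquareError.
End Interpolation.

(** * Normal equations, the optimal characteristic and its uniqueness *)

Section OptimalEstimate.
Context {R : realType}.
Local Notation mR := (measurableTypeR R).
Local Notation leb := (@lebesgue_measure R).
Local Notation D := (@circle R : set mR).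
Variables (f g : mR -> R) (N : nat) (a : 'cV[R[i]]_N.+1).

Hypothesis f0 : forall x, D x -> 0 <= f x.
Hypothesis g0 : forall x, D x -> 0 <= g x.
Hypothesis iF : leb.-integrable D (EFin \o f).
Hypothesis iG : leb.-integrable D (EFin \o g).
Hypothesis fg_minimal : minimality f g.

Let w (x : mR) := f x + g x.
Local Notation L2w := (L2 leb D (density w)).
Local Notation normsqw := (normsq leb D (density w)).
Local Notation innerw := (inner leb D (density w)).

Let mD := @measurable_circle R.
Let mf := measurable_weight iF.
Let mg := measurable_weight iG.
Let w0 : forall x, D x -> 0 <= w x := sum_density_ge0 f0 g0.
Let iw : leb.-integrable D (EFin \o w) := integrable_sum_density iF iG.
Let mw := measurable_weight iw.
Let dw0 := density_ge0 w0.
Let mdw := measurable_density mw.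
Let idw := integrable_density iw.
Let phi := dual_chi w.
Let phiL k : L2w (phi k) := L2_dual_chi w0 iw fg_minimal k.
Let mV := measurable_inv_weight w0 iw.

Local Notation B := (matB f g N).
Local Notation Rm := (matR f g N).
Local Notation Q := (matQ f g N).

Let wE x : f x + g x = w x. Proof. by []. Qed.

(** Lets the completed square hold at zeros of w too, where real division by w returns 0. *)
Let fwE x : D x -> w x = 0 -> f x = 0 /\ g x = 0.
Proof.
move=> Dx wx; have := f0 Dx; have := g0 Dx; move: wx; rewrite /w => wx h1 h2.
by split; lra.
Qed.

Let ratio_itv x : D x -> 0 <= f x / w x <= 1.
Proof.
move=> Dx; rewrite divr_ge0 ?f0 ?w0//=.
have [wx|wx] := eqVneq (w x) 0; first by rewrite wx invr0 mulr0.
have wp : 0 < w x by rewrite lt_neqAle eq_sym wx w0.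
by rewrite ler_pdivrMr// mul1r lerDl g0.
Qed.

Let mratio : measurable_fun D (fun x => f x / w x).
Proof. exact: measurable_funM. Qed.

Let iratio : leb.-integrable D (EFin \o (fun x => f x / w x)).
Proof.
apply: (le_integrable mD _ _ (integrable_circle_cst 1)); first exact/measurable_EFinP.
move=> x Dx; have /andP[h1 h2] := ratio_itv Dx.
by rewrite /= lee_fin normr1 ger0_norm.
Qed.

Let q x := f x * g x / w x.
Let qE x : q x = f x / w x * g x. Proof. by rewrite /q mulrAC. Qed.
Let q0 x : D x -> 0 <= q x.
Proof. by move=> Dx; rewrite qE mulr_ge0 ?g0//; have /andP[] := ratio_itv Dx. Qed.

Let iq : leb.-integrable D (EFin \o q).
Proof.
have mq : measurable_fun D q.
  by apply: measurable_funM => //; exact: measurable_funM.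
apply: (le_integrable mD _ _ iG); first exact/measurable_EFinP.
move=> x Dx; rewrite /= lee_fin !ger0_norm ?q0 ?g0// qE.
by rewrite ler_piMl ?g0//; have /andP[] := ratio_itv Dx.
Qed.

Let chiw k x : R[i] := chi k x * (f x / w x)%:C.

Let chiwL k : L2w (chiw k).
Proof.
apply: (L2_bounded dw0 idw (M := 1)).
  by apply: cmeasurableM; [exact: cmeasurable_chi | exact: cmeasurableC].
move=> x Dx; rewrite sqmodM sqmod_chi mul1r sqmodC.
by have /andP[h1 h2] := ratio_itv Dx; rewrite expr_le1.
Qed.

(* The minimizer of [Delta f g a] when all frequencies are observed. *)
Let target x : R[i] := trigpoly a x * (f x / w x)%:C.

Let targetE : target = fun x => \sum_(k < N.+1) a k 0 * chiw k x.
Proof.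
apply/funext => x; rewrite /target /trigpoly mulr_suml.
by apply: eq_bigr => k _; rewrite -mulrA.
Qed.

Let targetL : L2w target.
Proof. by rewrite targetE; apply: (L2_sum mD mdw dw0) => k _; exact: chiwL. Qed.

Let target_phi (j : 'I_N.+1) : innerw target (phi j) = (Rm *m a) j 0.
Proof.
rewrite targetE (inner_suml mD mdw dw0)// mxE; apply: eq_bigr => k _.
rewrite !mxE mulrC; congr (_ * _).
rewrite /chiw (inner_dual_chi j k iratio); first by rewrite opprB.
move=> x Dx; have [wx|wx] := eqVneq (w x) 0; first by rewrite wx invr0 !mulr0.
by rewrite -mulrA mulVf// mulr1.
Qed.

Let comb (c : 'cV[R[i]]_N.+1) x : R[i] := \sum_(k < N.+1) c k 0 * phi k x.

Let combL c : L2w (comb c).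
Proof. by apply: (L2_sum mD mdw dw0) => k _; exact: phiL. Qed.

Let comb_phi c (j : 'I_N.+1) : innerw (comb c) (phi j) = (B *m c) j 0.
Proof.
rewrite /comb (inner_suml mD mdw dw0)// mxE; apply: eq_bigr => k _.
by rewrite !mxE mulrC (dual_chi_gram w0 iw fg_minimal) opprB.
Qed.

Let inner_comb u c : L2w u ->
  innerw u (comb c) = \sum_(k < N.+1) conjc (c k 0) * innerw u (phi k).
Proof. by move=> uL; rewrite /comb (inner_sumr mD mdw dw0). Qed.

Let comb_normsq c : (normsqw (comb c))%:C = dotc (B *m c) c.
Proof.
rewrite -inner_normsq// inner_comb//; apply: eq_bigr => k _.
by rewrite comb_phi mulrC.
Qed.

(** B is the Gram matrix of the dual system. A kernel vector gives a combination of norm 0, and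
    pairing [chi j] with it recovers, by biorthogonality, the conjugate of each coefficient. The
    transpose appears because row freeness concerns the left kernel. *)
Lemma matB_unit : B \in unitmx.
Proof.
rewrite -unitmx_tr -row_free_unit; apply: inj_row_free => v vB.
have Bv : B *m v^T = 0 by rewrite -[B]trmxK -trmx_mul vB trmx0.
have n0 : normsqw (comb v^T) = 0.
  have := comb_normsq v^T; rewrite Bv /dotc big1 => [[]//|k _].
  by rewrite mxE mul0r.
apply/rowP => j; rewrite mxE; apply/eqP; rewrite -sqmod_eq0 -sqmod_conj.
have chiL := L2_chi dw0 idw j.
have -> : conjc (v 0 j) = innerw (chi j) (comb v^T).
  rewrite inner_comb// (bigD1 j)//= (chi_dual_chi w0 iw fg_minimal) eqxx mulr1.
  rewrite mxE big1 ?addr0// => k kj.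
  rewrite (chi_dual_chi w0 iw fg_minimal) eqz_nat.
  have -> : (j == k :> nat) = false by apply/negbTE; rewrite val_eqE eq_sym.
  by rewrite mulr0.
rewrite eq_le sqmod_ge0 andbT.
have := cauchy_schwarz mD mdw dw0 chiL (combL v^T).
by rewrite n0 mulr0.
Qed.

Let c := invmx B *m (Rm *m a).

Let Bc : B *m c = Rm *m a.
Proof. by rewrite /c mulmxA mulmxV ?matB_unit// mul1mx. Qed.

Let hoptE : hopt f g a = fun x => target x - comb c x.
Proof.
apply/funext => x; rewrite /hopt /target /comb; congr (_ - _).
rewrite /trigpoly mulr_suml; apply: eq_bigr => k _.
by rewrite /phi /dual_chi mulrA wE fmorphV.
Qed.

Let hoptL : L2w (hopt f g a).
Proof. by rewrite hoptE; exact: (L2B mD mdw dw0). Qed.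

Let hopt_phi (j : 'I_N.+1) : innerw (hopt f g a) (phi j) = 0.
Proof. by rewrite hoptE (innerBl mD mdw dw0)// target_phi comb_phi Bc subrr. Qed.

Lemma hopt_inL2N : inL2N w N (hopt f g a).
Proof.
apply: (orthogonal_inL2N w0 iw fg_minimal hoptL) => k kN.
by rewrite -ltnS in kN; exact: (hopt_phi (Ordinal kN)).
Qed.

Let err := dotc (Rm *m a) c + dotc (Q *m a) a.

Let normsq_aq : (normsq leb D (density q) (trigpoly a))%:C = dotc (Q *m a) a.
Proof.
have dq0 := density_ge0 q0; have idq := integrable_density iq.
have mdq := measurable_density (measurable_weight iq).
have chiL k : L2 leb D (density q) (chi k) := L2_chi dq0 idq k.
rewrite -inner_normsq// {2}/trigpoly (inner_sumr mD mdq dq0)//; last first.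
  exact: (L2_trigpoly_cV a q0 iq).
apply: eq_bigr => j _; rewrite mulrC; congr (_ * _).
rewrite /trigpoly (inner_suml mD mdq dq0)// mxE; apply: eq_bigr => k _.
by rewrite !mxE mulrC (inner_chi _ _ iq) opprB.
Qed.

(* Completing the square:
   [f |A - h|^2 + g |h|^2 = (f + g) |h - A f / (f + g)|^2 + |A|^2 f g / (f + g)]. *)
Let Delta_target h : L2w h -> Delta f g a h =
  (normsqw (fun x => h x - target x) + normsq leb D (density q) (trigpoly a))%:E.
Proof.
move=> hL; rewrite (DeltaE a f0 g0 iF iG hL).
have [hf hg] := (L2_sum_density f0 g0 iF iG h).1 hL.
have df0 := density_ge0 f0; have dg0 := density_ge0 g0.
have mdf := measurable_density mf; have mdg := measurable_density mg.
have ahL := L2B mD mdf df0 (L2_trigpoly_cV a f0 iF) hf.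
have htL := L2B mD mdw dw0 hL targetL.
have aqL := L2_trigpoly_cV a q0 iq.
have dq0 := density_ge0 q0; have mdq := measurable_density (measurable_weight iq).
rewrite !EFinD -(enormsqE df0 ahL) -(enormsqE dg0 hg) -(enormsqE dw0 htL).
rewrite -(enormsqE dq0 aqL) /enormsq -!ge0_integralD//.
- apply: eq_integral => x; rewrite inE => Dx; rewrite -!EFinD; congr (_%:E).
  rewrite /density !(mulrCA _ (2 * pi)^-1) -!mulrDr; congr (_ * _).
  rewrite /target; move: (trigpoly a x) (h x) => [a1 a2] [h1 h2].
  have [wx|wx] := eqVneq (w x) 0.
    by rewrite /q wx; have [-> ->] := fwE Dx wx; rewrite !mul0r !mulr0.
  rewrite /q /sqmod /=; move: wx; rewrite /w => wx.
  by field.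
- by move=> x Dx; rewrite lee_fin mulr_ge0 ?sqmod_ge0 ?dw0.
- apply/measurable_EFinP; apply: measurable_funM => //.
  by apply: measurable_sqmod; exact: htL.1.
- by move=> x Dx; rewrite lee_fin mulr_ge0 ?sqmod_ge0 ?dq0.
- apply/measurable_EFinP; apply: measurable_funM => //.
  by apply: measurable_sqmod; exact: aqL.1.
- by move=> x Dx; rewrite lee_fin mulr_ge0 ?sqmod_ge0 ?df0.
- apply/measurable_EFinP; apply: measurable_funM => //.
  by apply: measurable_sqmod; exact: ahL.1.
- by move=> x Dx; rewrite lee_fin mulr_ge0 ?sqmod_ge0 ?dg0.
- apply/measurable_EFinP; apply: measurable_funM => //.
  by apply: measurable_sqmod; exact: hg.1.
Qed.

Lemma errE : err = (normsqw (comb c) + normsq leb D (density q) (trigpoly a))%:C.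
Proof. by rewrite rmorphD/= comb_normsq normsq_aq Bc. Qed.

(** Pythagoras for h - target = (h - hopt) - comb: h - hopt is orthogonal to the dual system, so the
    excess over the minimum is exactly a squared distance. This yields optimality and uniqueness
    together. *)
Lemma Delta_hopt h : inL2N w N h -> Delta f g a h =
  (normsqw (fun x => h x - hopt f g a x) + complex.Re err)%:E.
Proof.
move=> hN; have [/(inL2E _ mw w0) hL _] := hN.
rewrite (Delta_target hL) errE /= addrA; congr (_ + _)%:E.
have hhL := L2B mD mdw dw0 hL hoptL.
have -> : (fun x => h x - target x) = (fun x => (h x - hopt f g a x) - comb c x).
  by apply/funext => x; rewrite hoptE; ring.
rewrite (normsqB mD mdw dw0)// inner_comb// big1 ?mulr0 ?subr0// => k _.
rewrite (innerBl mD mdw dw0)// hopt_phi subr0.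
by rewrite (inL2N_orthogonal w0 iw fg_minimal hN) ?mulr0// -ltnS.
Qed.

(** A vanishing norm forces equality only where the weight is positive, which by minimality is
    almost everywhere. *)
Lemma eq_hopt_ae h : L2w h -> normsqw (fun x => h x - hopt f g a x) = 0 ->
  {ae leb, forall x, D x -> h x = hopt f g a x}.
Proof.
move=> hL n0; have hhL := L2B mD mdw dw0 hL hoptL.
have md : measurable_fun D (EFin \o (fun x => sqmod (h x - hopt f g a x) * density w x)).
  apply/measurable_EFinP; apply: measurable_funM => //.
  by apply: measurable_sqmod; exact: hhL.1.
have : (\int[leb]_(x in D) `|(EFin \o (fun x =>
    sqmod (h x - hopt f g a x) * density w x)%R) x|)%E = 0%E.
  have <- : enormsq leb D (density w) (fun x => h x - hopt f g a x) = 0%E.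
    by rewrite (enormsqE dw0 hhL) n0.
  apply: eq_integral => x; rewrite inE => Dx; rewrite gee0_abs//.
  by rewrite lee_fin mulr_ge0 ?sqmod_ge0 ?dw0.
move=> /(ae_eq_integral_abs leb mD md) H1.
have H2 := weight_gt0_ae w0 iw fg_minimal.
move: H1 H2; apply: filterS2 => x Hx wx Dx.
have [/eqP] := Hx Dx; rewrite mulf_eq0 sqmod_eq0 subr_eq0 => /orP[/eqP//|].
by rewrite mulf_eq0 gt_eqF ?pi2_gt0//= gt_eqF// wx.
Qed.

End OptimalEstimate.

Theorem theorem7p1 (R : realType) (d : measure_display) (T : measurableType d)
  (P : probability T R) (xi eta : int -> T -> R[i]) (f g : R -> R)
  (Zxi Zeta : set R -> T -> R[i]) (N : nat) (a : 'cV[R[i]]_N.+1)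
  (xi_stationary : wide_sense_stationary P xi)
  (eta_stationary : wide_sense_stationary P eta)
  (xi_mean : zero_mean P xi) (eta_mean : zero_mean P eta)
  (xi_eta_uncorrelated : uncorrelated P xi eta)
  (xi_density : spectral_density P xi f)
  (eta_density : spectral_density P eta g)
  (Zxi_orthogonal : orthogonal_stochastic_measure P f Zxi)
  (Zeta_orthogonal : orthogonal_stochastic_measure P g Zeta)
  (xi_spectral : forall j, stochastic_integral P f Zxi (chi j) (xi j))
  (eta_spectral : forall j, stochastic_integral P g Zeta (chi j) (eta j))
  (fg_minimal : minimality f g) :
  let B := matB f g N in
  let Rm := matR f g N in
  let Q := matQ f g N in
  let h := hopt f g a in
  let err := dotc (Rm *m a) (invmx B *m (Rm *m a)) + dotc (Q *m a) a in
  [/\ B \in unitmx,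
      exists Y, optimal_linear_estimate f g P Zxi Zeta a h Y,
      forall h' Y, linear_estimate f g N P Zxi Zeta h' Y ->
        Delta f g a h' = mean_square P (fun t => functional xi a t - Y t) &
      forall h' Y, optimal_linear_estimate f g P Zxi Zeta a h' Y ->
        [/\ {ae lebesgue_measure, forall x, circle x -> h' x = h x},
            Delta f g a h' = mean_square P (fun t => functional xi a t - Y t),
            mean_square P (fun t => functional xi a t - Y t)
              = (complex.Re err)%:E &
            complex.Im err = 0]].
Proof.
have [f0 iF _] := xi_density; have [g0 iG _] := eta_density.
have xiL j : L2 P setT (fun=> 1) (xi j).
  by apply/second_orderE; have [] := xi_stationary.
have etaL j : L2 P setT (fun=> 1) (eta j).
  by apply/second_orderE; have [] := eta_stationary.
have mse := mean_square_error a f0 g0 iF iG xiL etaL xi_mean eta_mean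
  xi_eta_uncorrelated xi_density eta_density Zxi_orthogonal Zeta_orthogonal
  xi_spectral eta_spectral.
have hN := hopt_inL2N a f0 g0 iF iG fg_minimal.
have DE := Delta_hopt a f0 g0 iF iG fg_minimal.
have w0 := sum_density_ge0 f0 g0; have iw := integrable_sum_density iF iG.
have dw0 := density_ge0 w0.
move=> B Rm Q h err; split.
- exact: matB_unit f0 g0 iF iG fg_minimal.
- have [Y HY] := linear_estimate_exists f0 g0 iF iG Zxi_orthogonal Zeta_orthogonal hN.
  exists Y; split => // h' h'N; rewrite !DE// lee_fin lerD2r.
  by rewrite normsq_subrr (normsq_ge0 _ dw0).
- exact: mse.
- move=> h' Y [HY opt]; have h'N := HY.1.
  have [/(inL2E _ (measurable_weight iw) w0) h'L _] := h'N.
  (* Optimality of h' is tested against [h] itself; by [DE] the excess error of h' is its squared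
     distance to [h]. *)
  have n0 : normsq lebesgue_measure circle (density (fun x => f x + g x))
      (fun x => h' x - h x) = 0.
    have := opt _ hN; rewrite !DE// lee_fin lerD2r normsq_subrr => le0.
    by apply/eqP; rewrite eq_le le0 (normsq_ge0 _ dw0).
  split.
  + exact: (eq_hopt_ae f0 g0 iF iG fg_minimal h'L n0).
  + exact: mse.
  + by rewrite -(mse _ _ HY) DE// n0 add0r.
  + by rewrite /err (errE a f0 g0 iF iG fg_minimal).
Qed.
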